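(* For all integers $n\geq 0$ and all even integers $k\geq 6$, we have $D^nH_k\in\Omega$. Conversely, if $f\in\mathcal{E}\cap\Omega$, then $f$ is a (finite) linear combination of the forms $D^nH_k$ with $n\geq 0$ and $k\geq 6$ even.
   Context: Set $q=e^{2\pi i\tau}$ with $\tau$ in the upper half plane and $D:=\frac{1}{2\pi i}\frac{d}{d\tau}=q\frac{d}{dq}$. For even $k\geq 2$ let $$G_k(\tau):=-\frac{B_k}{2k}+\sum_{n\geq 1}\sigma_{k-1}(n)q^n,\qquad \sigma_{k-1}(n)=\sum_{d\mid n}d^{k-1},$$ with $B_k$ the Bernoulli numbers. The algebra of quasimodular forms is $\widetilde M=\mathbb{C}[G_2,G_4,G_6]$; it contains every $G_k$ with $k\ge 2$ even and is closed under $D$. $\mathcal{E}$ (the quasimodular Eisenstein space) is the complex vector subspace of $\widetilde M$ spanned by the $D^nG_k$ with $n\geq 0$ and $k\geq 2$ even. $\Omega$ is the set of prime-detecting quasimodular forms: those quasimodular forms $f=\sum_{n\geq 0}b_n(f)q^n$ such that $b_n(f)\geq 0$ for all positive integers $n$, and such that for $n\geq 2$ one has $b_n(f)=0$ if and only if $n$ is prime. For even $k\geq 6$, $$H_k:=\begin{cases}\frac16\left((D^2-D+1)G_2-G_4\right)& k=6,\\[2pt] \frac1{24}\left(-D^2G_{k-6}+(D^2+1)G_{k-4}-G_{k-2}\right)& k\geq 8.\end{cases}$$ *)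

(* Defs.v *)
From HB Require Import structures.
From mathcomp Require Import all_boot all_order all_algebra.
From mathcomp Require Import complex.
From mathcomp Require Import all_classical all_reals all_analysis.
Set Implicit Arguments.
Unset Strict Implicit.
Unset Printing Implicit Defensive.
Import Order.TTheory GRing.Theory Num.Theory.
Import numFieldNormedType.Exports.
Local Open Scope classical_set_scope.
Local Open Scope ring_scope.

(* [:: B_0; ...; B_(n-1)], with B_1 = -1/2 *)
Fixpoint bernoulli_seq (n : nat) : seq rat :=
  if n is m.+1 then
    let s := bernoulli_seq m in
    rcons s (((m == 0%N)%:R - \sum_(j < m) 'C(m.+1, j)%:R * s`_j) / m.+1%:R)
  else [::].

Definition bernoulli (n : nat) : rat := (bernoulli_seq n.+1)`_n.

Lemma size_bernoulli_seq n : size (bernoulli_seq n) = n.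
Proof. by elim: n => //= n IHn; rewrite size_rcons IHn. Qed.

Lemma nth_bernoulli_seq n j : (j < n)%N -> (bernoulli_seq n)`_j = bernoulli j.
Proof.
elim: n => // n IHn; rewrite ltnS leq_eqVlt => /predU1P[-> // | ltjn].
by rewrite /= nth_rcons size_bernoulli_seq ltjn IHn.
Qed.

Lemma bernoulliP n :
  \sum_(j < n.+1) 'C(n.+1, j)%:R * bernoulli j = (n == 0%N)%:R.
Proof.
rewrite big_ord_recr /= binSn {2}/bernoulli /= nth_rcons size_bernoulli_seq.
rewrite ltnn eqxx mulrC divfK ?pnatr_eq0 //.
under [X in _ + (_ - X)]eq_bigr => j _ do rewrite nth_bernoulli_seq //.
by rewrite addrC subrK.
Qed.

Definition sigma (m n : nat) : nat := \sum_(d <- divisors n) d ^ m.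

Definition lin_span (K : pzRingType) (V : lmodType K) (S : set V) : set V :=
  [set v | exists (n : nat) (c : 'I_n -> K) (w : 'I_n -> V),
     (forall i, S (w i)) /\ v = \sum_(i < n) c i *: w i].

Section Forms.
Variable R : realType.

(* [R[i]^o] is [R[i]] as a normed module over itself; it carries the topology
   used for series and complex derivatives. *)
Local Notation C := (R[i]^o).

Definition uhp : Type := {z : R[i] | 0 < complex.Im z}.

Local Notation form := (uhp -> C).

Definition cexp (z : R[i]) : R[i] :=
  ((expR (complex.Re z) * cos (complex.Im z))
   +i* (expR (complex.Re z) * sin (complex.Im z)))%C.

Definition two_pi_i : R[i] := (0 +i* (2 * pi))%C.

Definition q (tau : uhp) : C := cexp (two_pi_i * val tau).

Definition extend (f : form) (z : C) : C := oapp f 0 (insub (z : R[i])).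

(* The upper half plane is open, so the value of [extend f] off it is
   irrelevant to the derivative. *)
Definition D (f : form) : form :=
  fun tau => two_pi_i^-1 * derive1 (extend f) (val tau).

Definition G (k : nat) : form := fun tau =>
  - ratr (bernoulli k) / (2 * k)%:R
  + limn (fun N => \sum_(1 <= n < N) (sigma k.-1 n)%:R * q tau ^+ n).

(* C[G_2, G_4, G_6], as the subalgebra of functions on the upper half plane
   generated by G_2, G_4 and G_6. *)
Inductive quasimodular : set form :=
| quasimodular_cst (c : C) : quasimodular (fun=> c)
| quasimodular_G2 : quasimodular (G 2)
| quasimodular_G4 : quasimodular (G 4)
| quasimodular_G6 : quasimodular (G 6)
| quasimodular_add f g :
    quasimodular f -> quasimodular g -> quasimodular (f + g)
| quasimodular_mul f g :
    quasimodular f -> quasimodular g -> quasimodular (f * g).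

Definition q_expansion (f : form) (b : nat -> C) : Prop :=
  forall tau : uhp, series (fun n => b n * q tau ^+ n) @ \oo --> f tau.

Definition Eisenstein_space : set form :=
  lin_span [set g | exists n k : nat,
    [/\ (2 <= k)%N, ~~ odd k & g = iter n D (G k)]].

(* In the partial order of [R[i]], [0 <= z] says that z is real and
   nonnegative. *)
Definition Omega : set form :=
  [set f | quasimodular f /\
     exists b : nat -> R[i],
       [/\ q_expansion f b,
           forall n : nat, (0 < n)%N -> 0 <= b n
         & forall n : nat, (2 <= n)%N -> (b n = 0 <-> prime n)]].

Definition H (k : nat) : form :=
  if k == 6%N then 6^-1 *: ((iter 2 D (G 2) - D (G 2) + G 2) - G 4)
  else 24^-1 *: (- iter 2 D (G (k - 6))
                 + (iter 2 D (G (k - 4)) + G (k - 4)) - G (k - 2)).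

End Forms.

Arguments D {R}.
Arguments G {R}.
Arguments H {R}.
Arguments quasimodular {R}.
Arguments Omega {R}.
Arguments Eisenstein_space {R}.

(* Main.v *)
Require Import Defs.
From mathcomp Require Import all_boot all_order all_algebra.
From mathcomp Require Import complex.
From mathcomp Require Import all_classical all_reals all_analysis.
From mathcomp Require Import ring lra zify.
Set Implicit Arguments.
Unset Strict Implicit.
Unset Printing Implicit Defensive.
Import Order.TTheory GRing.Theory Num.Theory.
Import numFieldNormedType.Exports.
Local Open Scope classical_set_scope.
Local Open Scope ring_scope.

(** * Prime-detecting quasimodular forms in the Eisenstein space

    A form in the Eisenstein space is governed by its Fourier coefficients: for
    [n > 0] the [n]-th coefficient of [G k] is the sum of [d ^ (k - 1)] over the
    divisors [d] of [n], and [D] multiplies the [n]-th coefficient by [n].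

    Positivity. For [k >= 8] the definition of [H k] makes its [n]-th
    coefficient a positive multiple of
      [\sum_(d | n) d ^ (k - 7) * (d ^ 2 - 1) * (n ^ 2 - d ^ 2)],
    whose terms vanish at [d = 1] and [d = n] and are positive in between, so
    that the sum vanishes exactly at the primes. For [k = 6] the terms
    [d * (n ^ 2 - n + 1 - d ^ 2)] at [d = 1] and [d = n] cancel each other and
    the others are positive ([H_coefE], [proper_sum_eq0]).

    Quasimodularity. One needs that [C[G_2, G_4, G_6]] contains every [G k] and
    is stable under [D]. Power series that converge on the disc multiply by
    convolution of coefficients ([q_expansionM]) and are determined by them
    ([q_expansion_eq]), so this is a statement about convolutions of divisor
    sums. It follows from an identity of Liouville ([liouville_identity]): if
    [h x y] is an even symmetric function of the three numbers [x], [y] and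
    [- (x + y)], then the sum of [h a b - h a (- b)] over the solutions of
    [a * x + b * y = n] in positive integers reduces to sums over the divisors
    of [n], because the substitution [(a, b, x, y) -> (a - b, b, x, x + y)]
    exchanges the regions [b < a] and [x < y]. Two choices of [h] suffice, with
    [m] even and [z = x + y]:
    - [x ^ m + y ^ m + z ^ m] expresses [D G_m] through products [G_i * G_j]
      and [G_(m + 2)] ([subalg_theta_divisor_seq]); it is the heat equation of
      the theta function;
    - [x * y * z * (z ^ (m - 1) - x ^ (m - 1) - y ^ (m - 1))] expresses
      [G_(m + 4)] through products of lower [G_i] ([subalg_divisor_seq_step]);
      it is the differential equation of the Weierstrass function.
    The divisor sums on the right are sums of powers over an interval, which
    Faulhaber's formula turns into odd polynomials in the divisor
    ([faulhaber]).

    Converse. The definition of [H (k + 2)] can be solved for [G k] when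
    [k >= 4], so every element of the Eisenstein space is a combination of the
    [D ^ n H_k] plus a form [P(D) G_2] with [P] a polynomial
    ([reducible_iterD_G]). At a prime [p] the coefficient of the first summand
    vanishes, and that of the second is [P(p) * (p + 1)]. Since a form
    determines its coefficients ([q_expansion_inj]), [P] vanishes at all primes
    if the form detects primes, and is therefore zero. *)

(** * Liouville's identity *)

(** Reindexing along a bijection that is only given on the elements of two
    duplicate-free sequences; the inverse [g] spares finite index types. *)
Lemma big_seq_bij (V : nmodType) (I J : eqType) (s : seq I) (t : seq J)
    (P : pred I) (Q : pred J) (f : I -> J) (g : J -> I) (F : J -> V) :
  uniq s -> uniq t ->
  (forall i, i \in s -> P i -> [/\ f i \in t, Q (f i) & g (f i) = i]) ->
  (forall j, j \in t -> Q j -> [/\ g j \in s, P (g j) & f (g j) = j]) ->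
  \sum_(j <- t | Q j) F j = \sum_(i <- s | P i) F (f i).
Proof.
move=> us ut fP gP; rewrite -[LHS]big_filter -[RHS]big_filter -(big_map f xpredT).
apply: perm_big; apply: uniq_perm.
- exact: filter_uniq.
- rewrite map_inj_in_uniq ?filter_uniq// => i j; rewrite !mem_filter.
  move=> /andP[Pi si] /andP[Pj sj] fij.
  by have [_ _ <-] := fP _ si Pi; have [_ _ <-] := fP _ sj Pj; rewrite fij.
- move=> j; rewrite mem_filter; apply/andP/mapP => [[Qj tj]|[k]].
    by have [sgj Pgj <-] := gP _ tj Qj; exists (g j); rewrite ?mem_filter ?Pgj.
  by rewrite mem_filter => /andP[Pk sk] ->; have [-> ->] := fP _ sk Pk.
Qed.

(** [divisors 0] is [[:: 1]], whereas sums over the divisors of the index of a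
    power series without constant term have to vanish at [0]. *)
Definition divs (n : nat) : seq nat := if n is 0 then [::] else divisors n.

Lemma mem_divs n d : (d \in divs n) = (0 < n)%N && (d %| n)%N.
Proof. by case: n => // n; rewrite -dvdn_divisors. Qed.

Lemma divs_uniq n : uniq (divs n).
Proof. by case: n => // n; apply: divisors_uniq. Qed.

Definition factorizations (n : nat) : seq (nat * nat) :=
  [seq (d, n %/ d)%N | d <- divs n].

Lemma mem_factorizations n a x :
  ((a, x) \in factorizations n) = [&& 0 < a, 0 < x & a * x == n]%N.
Proof.
apply/mapP/and3P => [[d dn [-> ->]]|[a0 x0 /eqP <-]].
  move: dn; rewrite mem_divs => /andP[n0 dn]; have d0 := dvdn_gt0 n0 dn.
  by rewrite d0 divn_gt0// dvdn_leq// mulnC divnK.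
exists a; first by rewrite mem_divs muln_gt0 a0 x0 dvdn_mulr.
by rewrite mulKn.
Qed.

Lemma uniq_factorizations n : uniq (factorizations n).
Proof. by rewrite map_inj_uniq ?divs_uniq// => a b []. Qed.

(** The solutions [((a, x), (b, y))] of [a * x + b * y = n] in positive
    integers, grouped by the value of [a * x] so that monomials in [a] and [b]
    sum to convolutions of divisor functions. *)
Definition quads (n : nat) : seq ((nat * nat) * (nat * nat)) :=
  [seq t | m <- iota 0 n.+1,
     t <- [seq (p, p') | p <- factorizations m, p' <- factorizations (n - m)]].

Lemma mem_quads n a x b y :
  (((a, x), (b, y)) \in quads n) =
  [&& 0 < a, 0 < x, 0 < b, 0 < y & a * x + b * y == n]%N.
Proof.
apply/allpairsPdep/idP => [[m [t [mn /allpairsP[[p p'] /= [pm p'm ->]] []]]]|].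
  move=> /= e e'; move: pm p'm; rewrite -e -e' !mem_factorizations.
  move=> /and3P[-> -> /eqP axm] /and3P[-> -> /eqP bym] /=.
  by rewrite axm bym subnKC//; move: mn; rewrite mem_iota.
move=> /and5P[a0 x0 b0 y0 /eqP e]; exists (a * x)%N, ((a, x), (b, y)).
split => //; first by rewrite mem_iota -e/= add0n ltnS leq_addr.
apply/allpairsP; exists ((a, x), (b, y)); split => //=.
  by rewrite mem_factorizations a0 x0 eqxx.
by rewrite mem_factorizations b0 y0 -e addKn eqxx.
Qed.

Lemma uniq_quads n : uniq (quads n).
Proof.
apply: allpairs_uniq_dep => [|m _|].
- exact: iota_uniq.
- by apply: allpairs_uniq; rewrite ?uniq_factorizations// => -[? ?] [? ?].
- move=> [m t] [m' t'] /allpairsPdep[m1 [t1 [_ t1P [-> ->]]]].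
  move=> /allpairsPdep[m2 [t2 [_ t2P [-> ->]]]] /= t12.
  move: t1P t2P; rewrite -t12.
  move=> /allpairsP[[[a x] p'] /= [h1 _ e1]] /allpairsP[[[a' x'] p''] /= [h2 _ e2]].
  move: h1 h2; rewrite !mem_factorizations.
  rewrite e1 in e2; case: e2 => <- <- _.
  move=> /and3P[_ _ /eqP <-] /and3P[_ _ /eqP <-].
  by [].
Qed.

Section Combinatorics.
Variable F : numFieldType.

Definition divisor_seq (i n : nat) : F := \sum_(d <- divs n) d%:R ^+ i.

Definition convolution (a b : nat -> F) (n : nat) : F :=
  \sum_(0 <= m < n.+1) a m * b (n - m)%N.

Definition theta (a : nat -> F) (n : nat) : F := n%:R * a n.

Lemma sum_factorizations (f : nat -> F) n :
  \sum_(p <- factorizations n) f p.1 = \sum_(d <- divs n) f d.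
Proof. by rewrite big_map. Qed.

Lemma divisor_seqE i n : (0 < n)%N -> divisor_seq i n = (sigma i n)%:R.
Proof.
case: n => // n _.
by rewrite /divisor_seq /sigma natr_sum; apply: eq_bigr => d _; rewrite natrX.
Qed.

Lemma sum_quads_monomial i j n :
  \sum_(t <- quads n) t.1.1%:R ^+ i * t.2.1%:R ^+ j =
  convolution (divisor_seq i) (divisor_seq j) n.
Proof.
rewrite /quads big_allpairs_dep /convolution; apply: eq_bigr => m _.
rewrite big_allpairs /=.
rewrite /divisor_seq -!sum_factorizations mulr_suml.
by apply: eq_bigr => p _; rewrite mulr_sumr.
Qed.

(** The two hypotheses on [h] say that it is invariant, up to a common sign
    change, under all permutations of [x], [y] and [- (x + y)]. *)
Section Liouville.
Variable h : F -> F -> F.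
Hypothesis h_sym : forall x y, h x y = h y x.
Hypothesis h_rot : forall x y, h (- x) (x + y) = h x y.

Lemma h_even x y : h (- x) (- y) = h x y.
Proof.
rewrite -[RHS]h_rot [RHS]h_sym -[RHS]h_rot [RHS]h_sym -[RHS]h_rot [RHS]h_sym.
by congr h; ring.
Qed.

Lemma h_shear x y : h (x - y) y = h x (- y).
Proof. by rewrite h_sym -h_rot addrC subrK h_sym. Qed.

(** The substitution [(a, b, x, y) -> (a - b, b, x, x + y)] maps the solutions
    with [b < a] onto those with [x < y]; it preserves [a * x + b * y]. *)
Lemma sum_quads_shear n :
  \sum_(t <- quads n | (t.1.2 < t.2.2)%N) h t.1.1%:R t.2.1%:R =
  \sum_(t <- quads n | (t.2.1 < t.1.1)%N) h t.1.1%:R (- t.2.1%:R).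
Proof.
rewrite (big_seq_bij (s := quads n) (P := fun t => (t.2.1 < t.1.1)%N)
  (f := fun t => ((t.1.1 - t.2.1, t.1.2), (t.2.1, t.1.2 + t.2.2))%N)
  (g := fun t => ((t.1.1 + t.2.1, t.1.2), (t.2.1, t.2.2 - t.1.2))%N)); last 4 first.
- exact: uniq_quads.
- exact: uniq_quads.
- move=> [[a x] [b y]] /=; rewrite !mem_quads /=.
  move=> /and5P[a0 x0 b0 y0 /eqP <-] ab; split.
  + rewrite subn_gt0 ab x0 b0 addn_gt0 x0/=; apply/eqP.
    by rewrite mulnDr mulnBl addnA subnK// leq_mul2r (ltnW ab) orbT.
  + lia.
  + by rewrite subnK 1?ltnW// addKn.
- move=> [[a x] [b y]] /=; rewrite !mem_quads /=.
  move=> /and5P[a0 x0 b0 y0 /eqP <-] xy; split.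
  + rewrite addn_gt0 a0 x0 b0 subn_gt0 xy/=; apply/eqP.
    rewrite mulnDl mulnBr -addnA subnKC// leq_mul2l (ltnW xy) orbT//.
  + lia.
  + by rewrite addnK subnKC// ltnW.
by apply: eq_bigr => -[[a x] [b y]] /= ab; rewrite natrB 1?ltnW// h_shear.
Qed.

Lemma sum_quads_swap n (P : pred ((nat * nat) * (nat * nat))) (k : _ -> F) :
  \sum_(t <- quads n | P t) k t =
  \sum_(t <- quads n | P (t.2, t.1)) k (t.2, t.1).
Proof.
apply: (big_seq_bij (f := fun t => (t.2, t.1)) (g := fun t => (t.2, t.1)));
  rewrite ?uniq_quads// => -[[a x] [b y]]; rewrite !mem_quads /=
  => /and5P[-> -> -> -> /eqP <-] ->; rewrite addnC eqxx; split => //.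
Qed.

Lemma sum_trichotomy n (u v : (nat * nat) * (nat * nat) -> nat) (k : _ -> F) :
  \sum_(t <- quads n) k t =
  \sum_(t <- quads n | (u t < v t)%N) k t +
  \sum_(t <- quads n | (v t < u t)%N) k t + \sum_(t <- quads n | u t == v t) k t.
Proof.
rewrite (bigID (fun t => u t < v t)%N)/= -addrA; congr (_ + _).
rewrite (bigID (fun t => v t < u t)%N)/=; congr (_ + _); apply: eq_bigl => t.
  by case: ltngtP.
by case: ltngtP.
Qed.

Lemma sum_quads_diag_cofactor n :
  \sum_(t <- quads n | t.1.2 == t.2.2) h t.1.1%:R t.2.1%:R =
  \sum_(d <- divs n) \sum_(1 <= a < d) h a%:R (d%:R - a%:R).
Proof.
transitivity (\sum_(p <- [seq (d, a) | d <- divs n, a <- index_iota 1 d])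
   h p.2%:R (p.1%:R - p.2%:R)); last first.
  by rewrite big_allpairs_dep.
have memP d a : (d, a) \in [seq (d, a) | d <- divs n, a <- index_iota 1 d]
    -> [/\ (0 < n)%N, (d %| n)%N & (1 <= a < d)%N].
  move=> /allpairsPdep[d' [a' [dn' ad' [-> ->]]]].
  by move: dn' ad'; rewrite mem_divs mem_index_iota => /andP[].
rewrite (big_seq_bij (s := [seq (d, a) | d <- divs n, a <- index_iota 1 d])
  (P := xpredT)
  (f := fun p => ((p.2, n %/ p.1), (p.1 - p.2, n %/ p.1))%N)
  (g := fun t => (t.1.1 + t.2.1, t.1.1)%N)); last 4 first.
- apply: allpairs_uniq_dep => [|d _|[? ?] [? ?] _ _ []].
  + exact: divs_uniq.
  + exact: iota_uniq.
  + by move=> -> ->.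
- exact: uniq_quads.
- move=> [d a] /memP[n0 dn /andP[a0 ad]] _ /=; rewrite mem_quads eqxx.
  have d0 := dvdn_gt0 n0 dn.
  rewrite a0 subn_gt0 ad divn_gt0// dvdn_leq//= -mulnDl subnKC 1?ltnW//.
  by rewrite mulnC divnK// eqxx.
- move=> [[a x] [b y]] /=; rewrite mem_quads /= => /and5P[a0 x0 b0 _].
  move=> /[swap] /eqP <- /eqP <-; rewrite -mulnDl mulKn ?addn_gt0 ?a0// addKn.
  split=> //; apply/allpairsPdep; exists (a + b)%N, a; split => //.
    by rewrite mem_divs muln_gt0 addn_gt0 a0 x0 dvdn_mulr.
  by rewrite mem_index_iota; lia.
apply: eq_big_seq => -[d a] /memP[_ _ /andP[_ /ltnW ad]] /=.
by rewrite natrB.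
Qed.

Lemma sum_quads_diag n :
  \sum_(t <- quads n | t.1.1 == t.2.1) h 0 t.1.1%:R =
  \sum_(d <- divs n) (n %/ d - 1)%:R * h 0 d%:R.
Proof.
transitivity (\sum_(p <- [seq (d, x) | d <- divs n, x <- index_iota 1 (n %/ d)])
   h 0 p.1%:R); last first.
  rewrite big_allpairs_dep /=.
  by apply: eq_bigr => d _; rewrite sumr_const_nat mulr_natl.
have memP d x : (d, x) \in [seq (d, x) | d <- divs n, x <- index_iota 1 (n %/ d)]
    -> [/\ (0 < n)%N, (d %| n)%N & (1 <= x < n %/ d)%N].
  move=> /allpairsPdep[d' [a' [dn' ad' [-> ->]]]].
  by move: dn' ad'; rewrite mem_divs mem_index_iota => /andP[].
apply: (big_seq_bij (f := fun p => ((p.1, p.2), (p.1, n %/ p.1 - p.2))%N)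
  (g := fun t => (t.1.1, t.1.2))).
- apply: allpairs_uniq_dep => [|d _|[? ?] [? ?] _ _ []].
  + exact: divs_uniq.
  + exact: iota_uniq.
  + by move=> -> ->.
- exact: uniq_quads.
- move=> [d x] /memP[n0 dn /andP[x0 xd]] _ /=; rewrite mem_quads eqxx.
  have d0 := dvdn_gt0 n0 dn.
  rewrite d0 x0 subn_gt0 xd -mulnDr subnKC 1?ltnW//.
  by rewrite mulnC divnK// eqxx.
- move=> [[a x] [b y]] /=; rewrite mem_quads /= => /and5P[a0 x0 b0 y0].
  move=> /[swap] /eqP <- /eqP <-; rewrite -mulnDr mulKn// addKn.
  split=> //; apply/allpairsPdep; exists a, x; split => //.
    by rewrite mem_divs muln_gt0 addn_gt0 a0 x0 dvdn_mulr.
  by rewrite mem_index_iota mulKn//; lia.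
Qed.

(** Splitting the solutions according to the order of [x] and [y], respectively
    of [a] and [b], the off-diagonal parts of the two sums agree by
    [sum_quads_shear] and the symmetries of [h]; what is left are the diagonals
    [x = y] and [a = b]. *)
Theorem liouville_identity n :
  \sum_(t <- quads n) (h t.1.1%:R t.2.1%:R - h t.1.1%:R (- t.2.1%:R)) =
  \sum_(d <- divs n)
    (\sum_(1 <= a < d) h a%:R (d%:R - a%:R) - (n %/ d - 1)%:R * h 0 d%:R).
Proof.
rewrite !sumrB -sum_quads_diag_cofactor -sum_quads_diag.
rewrite (sum_trichotomy _ (fun t => t.1.2) (fun t => t.2.2)).
rewrite (sum_trichotomy _ (fun t => t.2.1) (fun t => t.1.1) (fun t => h _ (- _))).
have -> : \sum_(t <- quads n | (t.2.2 < t.1.2)%N) h t.1.1%:R t.2.1%:R =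
    \sum_(t <- quads n | (t.1.1 < t.2.1)%N) h t.1.1%:R (- t.2.1%:R).
  rewrite (sum_quads_swap n (fun t => t.2.2 < t.1.2)%N) /=.
  under eq_bigr do rewrite h_sym.
  rewrite sum_quads_shear.
  rewrite (sum_quads_swap n (fun t => t.2.1 < t.1.1)%N (fun t => h _ (- _))) /=.
  by apply: eq_bigr => t _; rewrite -h_even opprK h_sym.
rewrite sum_quads_shear.
have -> : \sum_(t <- quads n | t.2.1 == t.1.1) h t.1.1%:R (- t.2.1%:R) =
    \sum_(t <- quads n | t.1.1 == t.2.1) h 0 t.1.1%:R.
  apply: eq_big => [t|t /eqP ->]; first by rewrite eq_sym.
  by rewrite -h_rot subrr -h_even opprK oppr0 h_sym.
ring.
Qed.

End Liouville.
End Combinatorics.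

(** * Relations between divisor sums *)

Section EisensteinRelations.
Variable F : numFieldType.

Lemma sum_binomial_odd (x y : F) n :
  \sum_(i < n.+1 | odd i) (x ^+ (n - i) * y ^+ i) *+ 'C(n, i) =
  2^-1 * ((x + y) ^+ n - (x - y) ^+ n).
Proof.
rewrite exprDn exprBn -sumrB mulr_sumr big_mkcond; apply: eq_bigr => i _.
rewrite -signr_odd -mulrA -mulrnBl mulrnAr; case: (odd i).
  by congr (_ *+ _); rewrite expr1; field.
by rewrite expr0 mul1r subrr mulr0 mul0rn.
Qed.

Lemma sum_binomial_even (x y : F) n :
  \sum_(i < n.+1 | ~~ odd i) (x ^+ (n - i) * y ^+ i) *+ 'C(n, i) =
  2^-1 * ((x + y) ^+ n + (x - y) ^+ n).
Proof.
rewrite exprDn exprBn -big_split mulr_sumr big_mkcond; apply: eq_bigr => i _ /=.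
rewrite -signr_odd -mulrA -mulrnDl mulrnAr; case: (odd i) => /=.
  by rewrite expr1 mulN1r subrr mulr0 mul0rn.
by congr (_ *+ _); rewrite expr0; field.
Qed.

Lemma sum_binomial_odd1 (x : F) n :
  \sum_(i < n.+1 | odd i) x ^+ (n - i) *+ 'C(n, i) =
  2^-1 * ((x + 1) ^+ n - (x - 1) ^+ n).
Proof.
by rewrite -sum_binomial_odd; apply: eq_bigr => i _; rewrite expr1n mulr1.
Qed.

Lemma sum_binomial_even1 (x : F) n :
  \sum_(i < n.+1 | ~~ odd i) x ^+ (n - i) *+ 'C(n, i) =
  2^-1 * ((x + 1) ^+ n + (x - 1) ^+ n).
Proof.
by rewrite -sum_binomial_even; apply: eq_bigr => i _; rewrite expr1n mulr1.
Qed.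

(** Parity is tracked because the sum of [d ^ j] over the divisors of [n] is a
    coefficient of an Eisenstein series of even weight only for odd [j]. *)
Inductive parity_poly (k : nat) (e : bool) : (nat -> F) -> Prop :=
| parity_poly0 : parity_poly k e (fun=> 0)
| parity_polyM c j :
    (j < k)%N -> odd j = e -> parity_poly k e (fun d => c * d%:R ^+ j)
| parity_polyD f g : parity_poly k e f -> parity_poly k e g ->
    parity_poly k e (fun d => f d + g d).

Lemma parity_polyW k k' e f :
  (k <= k')%N -> parity_poly k e f -> parity_poly k' e f.
Proof.
move=> kk'; elim=> [|c j jk je|{}f g _ ? _ ?]; first exact: parity_poly0.
  by apply: parity_polyM => //; apply: leq_trans kk'.
exact: parity_polyD.
Qed.

Lemma parity_polyZ k e c f :
  parity_poly k e f -> parity_poly k e (fun d => c * f d).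
Proof.
elim=> [|c' j jk je|{}f g _ fP _ gP].
- by rewrite (_ : (fun _ => _) = fun=> 0); [exact: parity_poly0|apply/funext => d; rewrite mulr0].
- rewrite (_ : (fun _ => _) = fun d => c * c' * d%:R ^+ j).
    exact: parity_polyM.
  by apply/funext => d; rewrite mulrA.
- rewrite (_ : (fun _ => _) = fun d => c * f d + c * g d).
    exact: parity_polyD.
  by apply/funext => d; rewrite mulrDr.
Qed.

Lemma parity_polyX k e i f : parity_poly k e f ->
  parity_poly (i + k) (odd i (+) e) (fun d => d%:R ^+ i * f d).
Proof.
elim=> [|c j jk je|{}f g _ fP _ gP].
- by rewrite (_ : (fun _ => _) = fun=> 0); [exact: parity_poly0|apply/funext => d; rewrite mulr0].
- rewrite (_ : (fun _ => _) = fun d => c * d%:R ^+ (i + j)).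
    by apply: parity_polyM; rewrite ?ltn_add2l// oddD je.
  by apply/funext => d; rewrite mulrCA exprD.
- rewrite (_ : (fun _ => _) = fun d => d%:R ^+ i * f d + d%:R ^+ i * g d).
    exact: parity_polyD.
  by apply/funext => d; rewrite mulrDr.
Qed.

Lemma parity_poly_sum k e I (s : seq I) (P : pred I) (f : I -> nat -> F) :
  (forall i, P i -> parity_poly k e (f i)) ->
  parity_poly k e (fun d => \sum_(i <- s | P i) f i d).
Proof.
move=> fP; elim: s => [|i s IHs].
  rewrite (_ : (fun _ => _) = fun=> 0); first exact: parity_poly0.
  by apply/funext => d; rewrite big_nil.
case Pi : (P i); last first.
  by move: IHs; congr parity_poly; apply/funext => d; rewrite big_cons Pi.
rewrite (_ : (fun _ => _) = fun d => f i d + \sum_(i <- s | P i) f i d).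
  by apply: parity_polyD => //; apply: fP.
by apply/funext => d; rewrite big_cons Pi.
Qed.

(** The trapezoidal sum of [x ^+ i] over [0, d]: halving the end terms makes
    it a polynomial in [d] of a definite parity. *)
Definition trapezoid (i d : nat) : F :=
  2^-1 * \sum_(0 <= a < d) (a%:R ^+ i + a.+1%:R ^+ i).

Lemma trapezoidE i d : (0 < i)%N -> (0 < d)%N ->
  trapezoid i d = \sum_(1 <= a < d) a%:R ^+ i + 2^-1 * d%:R ^+ i.
Proof.
move=> i0; case: d => // d _; elim: d => [|d IHd].
  by rewrite /trapezoid big_nat1 big_geq// expr0n gtn_eqF// !add0r.
rewrite /trapezoid big_nat_recr//= mulrDr -/(trapezoid i d.+1) IHd.
by rewrite [in RHS]big_nat_recr//=; field.
Qed.

(** The left side telescopes: by the binomial formula the odd binomial sum of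
    the powers of [a] is [((a + 1) ^ n - (a - 1) ^ n) / 2]. *)
Lemma trapezoid_rec n d :
  \sum_(i < n.+1 | odd i) trapezoid (n - i) d *+ 'C(n, i) =
  4^-1 * ((d%:R - 1) ^+ n + 2 * d%:R ^+ n + (d%:R + 1) ^+ n
          - ((-1) ^+ n + 2 * 0 ^+ n + 1)).
Proof.
elim: d => [|d IHd].
  rewrite big1 => [|i _]; last by rewrite /trapezoid big_geq// mulr0 mul0rn.
  by rewrite sub0r add0r expr1n subrr mulr0.
under eq_bigr do rewrite /trapezoid big_nat_recr//= mulrDr mulrnDl -/(trapezoid _ _).
rewrite big_split IHd/=.
under [X in _ + X]eq_bigr => i _.
  rewrite mulrDr mulrnDl -!mulrnAr.
  over.
rewrite big_split -!mulr_sumr !sum_binomial_odd1/=.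
rewrite -(natr1 d) addrK; by field.
Qed.

(** [trapezoid_rec] expresses [trapezoid i] through the [trapezoid j] with
    [j < i] of the same parity and a polynomial of parity [i + 1]. *)
Lemma faulhaber i : parity_poly i.+1 (~~ odd i)
  (fun d => trapezoid i d - d%:R ^+ i.+1 / i.+1%:R).
Proof.
elim/ltn_ind: i => i IHi; set n := i.+1.
(* The polynomial, the constant and the remaining trapezoidal sums in
   [trapezoid_rec], solved for [trapezoid i]. *)
pose lo d : F := 2^-1 * \sum_(j < n.+1 | ~~ odd j && (0 < j)%N)
                  d%:R ^+ (n - j) *+ 'C(n, j).
pose cst : F := - 4^-1 * ((-1) ^+ n + 1).
pose tail d := \sum_(j < n.+1 | odd j && (1 < j)%N) trapezoid (n - j) d *+ 'C(n, j).
have n0 : n%:R != 0 :> F by rewrite pnatr_eq0.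
rewrite (_ : (fun _ => _) = fun d => n%:R^-1 * (lo d + (cst + - 1 * tail d))).
  apply: parity_polyZ; apply: parity_polyD; [|apply: parity_polyD].
  - apply: parity_polyZ; apply: parity_poly_sum => j /andP[je j0].
    rewrite (_ : (fun _ => _) = fun d => 'C(n, j)%:R * d%:R ^+ (n - j)).
      apply: parity_polyM; first by rewrite ltn_subrL j0.
      by rewrite oddB ?(negbTE je) ?addbF// -ltnS.
    by apply/funext => d; rewrite mulr_natl.
  - rewrite /cst -signr_odd /=; case: (odd i) => /=.
      rewrite (_ : (fun _ => _) = fun d => - 2^-1 * d%:R ^+ 0).
        exact: parity_polyM.
      by apply/funext => d; rewrite !expr0; field.
    by rewrite expr1 addNr mulr0; exact: parity_poly0.
  apply: parity_polyZ; apply: parity_poly_sum => j /andP[jo j1].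
  have jn : (j <= n)%N by rewrite -ltnS.
  pose r := (n - j)%N.
  have odd_r : odd r = odd i by rewrite /r oddB// jo addbT /n/= negbK.
  have ri : (r.+1 < n)%N by rewrite /r; lia.
  rewrite (_ : (fun _ => _) = fun d =>
     'C(n, j)%:R * ((trapezoid r d - d%:R ^+ r.+1 / r.+1%:R) +
        r.+1%:R^-1 * d%:R ^+ r.+1)).
    apply: parity_polyZ; apply: parity_polyD.
      rewrite -odd_r; apply: (parity_polyW (k := r.+1)); first exact: ltnW.
      by apply: IHi; move: ri; rewrite ltnS.
    by apply: parity_polyM => //=; rewrite odd_r.
  by apply/funext => d; rewrite [_^-1 * _]mulrC subrK mulr_natl.
apply/funext => d; apply: (mulfI n0); rewrite mulVKf// mulrBr.
rewrite [n%:R * (_ / _)]mulrC divfK//.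
have : \sum_(j < n.+1 | odd j) trapezoid (n - j) d *+ 'C(n, j) =
    n%:R * trapezoid i d + tail d.
  have lt1n : (1 < n.+1)%N by [].
  rewrite (bigD1 (Ordinal lt1n))//= subn1 bin1 mulr_natl; congr (_ + _).
  apply: eq_bigl => j; rewrite -val_eqE/=.
  by case: (val j) => [|[|?]].
rewrite trapezoid_rec => /esym/(canRL (addrK _)) ->.
have -> : lo d = 2^-1 * (2^-1 * ((d%:R + 1) ^+ n + (d%:R - 1) ^+ n) - d%:R ^+ n).
  congr (_ * _); rewrite -sum_binomial_even1 [in RHS](bigD1 ord0)//= bin0 subn0.
  by rewrite addrC addrK; apply: eq_bigl => j; rewrite -val_eqE/= lt0n.
by rewrite /cst expr0n/=; field.
Qed.

(** [A] is to be the set of coefficient sequences of the quasimodular forms;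
    convolution then corresponds to the product of forms. *)
Variable A : (nat -> F) -> Prop.
Hypothesis AD : forall a b, A a -> A b -> A (fun n => a n + b n).
Hypothesis AZ : forall c a, A a -> A (fun n => c * a n).
Hypothesis AM : forall a b, A a -> A b -> A (convolution a b).

Lemma subalg0 : A (@divisor_seq F 1) -> A (fun=> 0).
Proof.
by move=> /(AZ 0); congr A; apply/funext => n; rewrite mul0r.
Qed.

Lemma subalg_sum I (s : seq I) (P : pred I) (f : I -> nat -> F) :
  A (fun=> 0) -> (forall i, P i -> A (f i)) ->
  A (fun n => \sum_(i <- s | P i) f i n).
Proof.
move=> A0 fP; elim: s => [|i s IHs].
  by move: A0; congr A; apply/funext => d; rewrite big_nil.
case Pi : (P i); last first.
  by move: IHs; congr A; apply/funext => d; rewrite big_cons Pi.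
rewrite (_ : (fun _ => _) = fun d => f i d + \sum_(i <- s | P i) f i d).
  by apply: AD => //; apply: fP.
by apply/funext => d; rewrite big_cons Pi.
Qed.

Lemma subalg_divisor_sum k f : parity_poly k true f -> A (fun=> 0) ->
  (forall j, odd j -> (j < k)%N -> A (@divisor_seq F j)) ->
  A (fun n => \sum_(d <- divs n) f d).
Proof.
move=> fP A0 Ak; elim: fP => [|c j jk je|{}f g _ fP _ gP].
- by move: A0; congr A; apply/funext => n; rewrite big1.
- have := AZ c (Ak _ je jk); congr A; apply/funext => n.
  by rewrite /divisor_seq mulr_sumr.
- by have := AD fP gP; congr A; apply/funext => n; rewrite big_split.
Qed.

Lemma sum_rev_pow i d : \sum_(1 <= a < d) (d%:R - a%:R) ^+ i =
  \sum_(1 <= a < d) a%:R ^+ i :> F.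
Proof.
rewrite [RHS]big_nat_rev; apply: eq_big_nat => a /andP[a0 ad].
by rewrite -natrB 1?ltnW//; congr (_%:R ^+ _); lia.
Qed.

(** Liouville's identity for [h x y = x ^ n + y ^ n + (x + y) ^ n]. The left
    side is a combination of convolutions of divisor sums with odd exponents;
    since [h 0 d = 2 * d ^ n], the factor [n %/ d] on the right produces
    [theta]. *)
Lemma subalg_theta_divisor_seq n : ~~ odd n -> (1 < n)%N ->
  (forall j, odd j -> (j < n.+2)%N -> A (@divisor_seq F j)) ->
  A (theta (@divisor_seq F n.-1)).
Proof.
move=> en n1 Aj; have A1 := Aj 1%N isT isT; have A0 := subalg0 A1.
have n0 : (0 < n)%N := ltnW n1.
pose h (x y : F) := x ^+ n + y ^+ n + (x + y) ^+ n.
have h_sym x y : h x y = h y x by rewrite /h [y + x]addrC [y ^+ n + _]addrC.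
have even_pow (x : F) : (- x) ^+ n = x ^+ n by rewrite exprNn -signr_odd (negbTE en) mul1r.
have h_rot x y : h (- x) (x + y) = h x y.
  by rewrite /h even_pow addKr -!addrA [_ + y ^+ n]addrC.
pose f d : F := 2 * (trapezoid n d - d%:R ^+ n.+1 / n.+1%:R) +
                (2 / n.+1%:R + 1) * d%:R ^+ n.+1.
have fP : parity_poly n.+2 true f.
  apply: parity_polyD; last by apply: parity_polyM; rewrite //= en.
  apply: parity_polyZ; rewrite -en; apply: (parity_polyW (k := n.+1)) => //.
  exact: faulhaber.
pose g N : F := \sum_(i < n.+1 | odd i)
  'C(n, i)%:R * convolution (divisor_seq F (n - i)) (divisor_seq F i) N.
have Ag : A g.
  apply: subalg_sum => // i oi; apply: AZ; apply: AM; apply: Aj => //.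
  - by rewrite oddB ?(negbTE en) ?oi// -ltnS.
  - by rewrite ltnS leqW// leq_subr.
  - by rewrite ltnS ltnW.
have := AD (AZ 2^-1 (subalg_divisor_sum fP A0 Aj)) (AZ (-1) Ag).
congr A; apply/funext => N; rewrite /theta.
have := liouville_identity h_sym h_rot N.
have -> : \sum_(t <- quads N) (h t.1.1%:R t.2.1%:R - h t.1.1%:R (- t.2.1%:R)) = 2 * g N.
  rewrite mulr_sumr; under [RHS]eq_bigr => i _.
    rewrite -sum_quads_monomial mulrA mulr_sumr.
    over.
  rewrite exchange_big/=; apply: eq_bigr => t _; rewrite /h even_pow.
  rewrite opprD addrACA subrr add0r.
  have := sum_binomial_odd t.1.1%:R t.2.1%:R n.
  move=> /(congr1 (fun x => 2 * x)); rewrite mulVKf ?pnatr_eq0// => <-.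
  by rewrite mulr_sumr; apply: eq_bigr => i _; rewrite -mulr_natr -mulrA; ring.
have -> : \sum_(d <- divs N) (\sum_(1 <= a < d) h a%:R (d%:R - a%:R)
     - (N %/ d - 1)%:R * h 0 d%:R) =
   \sum_(d <- divs N) f d - 2 * (N%:R * divisor_seq F n.-1 N).
  rewrite /divisor_seq !mulr_sumr -sumrB; apply: eq_big_seq => d.
  rewrite mem_divs => /andP[N0 dN]; have d0 := dvdn_gt0 N0 dN.
  have -> : \sum_(1 <= a < d) h a%:R (d%:R - a%:R) =
     2 * (trapezoid n d - 2^-1 * d%:R ^+ n) + (d%:R - 1) * d%:R ^+ n :> F.
    rewrite trapezoidE// addrK /h 2!big_split/= sum_rev_pow mulr2n mulrDl mul1r.
    under [X in _ + X = _]eq_bigr do rewrite addrC subrK.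
    by rewrite sumr_const_nat -[_ *+ (d - 1)]mulr_natl natrB// mulr1.
  rewrite /h add0r expr0n gtn_eqF// add0r natrB; last by rewrite divn_gt0// dvdn_leq.
  have -> : N%:R = (N %/ d)%:R * d%:R :> F by rewrite -natrM divnK.
  rewrite -[in d%:R ^+ n](prednK n0) !exprS /f; rewrite exprS -[in d%:R ^+ n](prednK n0) exprS.
  have : n.+1%:R != 0 :> F by rewrite pnatr_eq0.
  move: (n.+1%:R) => m m0; field.
  by [].
move=> e.
have -> : N%:R * divisor_seq F n.-1 N = 2^-1 * (\sum_(d <- divs N) f d - 2 * g N).
  by rewrite e; field.
by field.
Qed.

(** Liouville's identity for [z ^ n * x * y - x ^ n * y * z - y ^ n * x * z] with
    [z = x + y]. As [h 0 d = 0], no derivative appears, and the sum of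
    [h a (d - a)] over [a] is an odd polynomial in [d] with leading term
    [c * d ^ (n + 3)]. *)
Lemma subalg_divisor_seq_step n : ~~ odd n -> (3 < n)%N ->
  (forall j, odd j -> (j < n.+3)%N -> A (@divisor_seq F j)) ->
  A (@divisor_seq F n.+3).
Proof.
move=> en n3 Aj; have A1 := Aj 1%N isT isT; have A0 := subalg0 A1.
have n0 : (0 < n)%N by apply: ltn_trans n3.
pose h (x y : F) := (x + y) ^+ n * (x * y) - x ^+ n * (y * (x + y)) - y ^+ n * (x * (x + y)).
have h_sym x y : h x y = h y x by rewrite /h [y + x]addrC; ring.
have even_pow (x : F) : (- x) ^+ n = x ^+ n by rewrite exprNn -signr_odd (negbTE en) mul1r.
have h_rot x y : h (- x) (x + y) = h x y.
  by rewrite /h even_pow addKr; ring.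
pose T i d : F := trapezoid i d - d%:R ^+ i.+1 / i.+1%:R.
pose f d : F := d%:R ^+ n.+1 * T 1 d + (- 1) * (d%:R ^+ n * T 2%N d)
  + ((- 2) * (d%:R ^+ 2 * T n d) + 2 * (d%:R ^+ 1 * T n.+1 d)).
pose c : F := 6^-1 - 2 / n.+1%:R + 2 / n.+2%:R.
(* [c] vanishes only if [(n + 1) * (n + 2) = 12], that is for [n = 2]. *)
have c0 : c != 0.
  have -> : c = (n.+1 * n.+2 - 12)%:R / (6 * n.+1%:R * n.+2%:R).
    rewrite natrB; last by nia.
    have : n.+2%:R != 0 :> F by rewrite pnatr_eq0.
    have : n.+1%:R != 0 :> F by rewrite pnatr_eq0.
    rewrite natrM /c -(natr1 n.+1); move: (n.+1%:R) => m m0 m1; field.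
    by rewrite m0 m1.
  by rewrite mulf_neq0 ?invr_eq0 ?mulf_neq0 ?pnatr_eq0//; nia.
have fP : parity_poly n.+3 true f.
  have T1 := parity_polyX n.+1 (faulhaber 1).
  have T2 := parity_polyX n (faulhaber 2).
  have Tn := parity_polyX 2 (faulhaber n).
  have TSn := parity_polyX 1 (faulhaber n.+1).
  move: T1 T2 Tn TSn; rewrite !addn2 !addn3 !add2n !add1n/= en/= => T1 T2 Tn TSn.
  apply: parity_polyD; apply: parity_polyD.
  - exact: T1.
  - apply: parity_polyZ; move: T2; rewrite (negbTE en); exact.
  - exact: parity_polyZ Tn.
  - exact: parity_polyZ TSn.
pose g N : F := \sum_(i < n.+1 | ~~ odd i)
    (2 * 'C(n, i)%:R) * convolution (divisor_seq F (n - i).+1) (divisor_seq F i.+1) N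
  + ((- 2) * convolution (divisor_seq F n.+1) (divisor_seq F 1) N
  + (- 2) * convolution (divisor_seq F 1) (divisor_seq F n.+1) N).
have ASn : A (divisor_seq F n.+1) by apply: Aj => //=; rewrite ltnS leqnSn.
have Ag : A g.
  apply: AD; last by apply: AD; apply: AZ; apply: AM.
  apply: subalg_sum => // i oi; apply: AZ; apply: AM; apply: Aj => //=.
  - by rewrite oddB ?(negbTE en) ?(negbTE oi)// -ltnS.
  - by rewrite !ltnS (leq_trans (leq_subr _ _)) ?leqnSn.
  - by rewrite ltnS leqW.
have := AZ c^-1 (AD Ag (AZ (-1) (subalg_divisor_sum fP A0 Aj))).
congr A; apply/funext => N.
have := liouville_identity h_sym h_rot N.
have -> : \sum_(t <- quads N) (h t.1.1%:R t.2.1%:R - h t.1.1%:R (- t.2.1%:R)) = g N.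
  rewrite /g -!sum_quads_monomial; under [in RHS]eq_bigr => i _.
    rewrite -sum_quads_monomial mulr_sumr.
    over.
  rewrite exchange_big !mulr_sumr -!big_split/=; apply: eq_bigr => t _.
  have := sum_binomial_even t.1.1%:R t.2.1%:R n.
  move: t.1.1%:R t.2.1%:R => a b e.
  have -> : \sum_(i < n.+1 | ~~ odd i)
      2 * 'C(n, i)%:R * (a ^+ (n - i).+1 * b ^+ i.+1) =
    a * b * ((a + b) ^+ n + (a - b) ^+ n).
    move: e => /(congr1 (fun x => 2 * (a * b) * x)).
    rewrite [_ * b * (_ + _)](_ : _ = 2 * (a * b) * (2^-1 * ((a + b) ^+ n + (a - b) ^+ n))); last by field.
    move=> <-; rewrite mulr_sumr; apply: eq_bigr => i _.
    by rewrite !exprS -[_ *+ 'C(n, i)]mulr_natr; ring.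
  by rewrite /h even_pow !exprS !expr0; ring.
have -> : \sum_(d <- divs N) (\sum_(1 <= a < d) h a%:R (d%:R - a%:R)
     - (N %/ d - 1)%:R * h 0 d%:R) =
   \sum_(d <- divs N) f d + c * divisor_seq F n.+3 N.
  rewrite /divisor_seq !mulr_sumr -big_split/=; apply: eq_big_seq => d.
  rewrite mem_divs => /andP[N0 dN]; have d0 := dvdn_gt0 N0 dN.
  have -> : h 0 d%:R = 0 by rewrite /h expr0n gtn_eqF// !mul0r !mulr0 !subr0.
  rewrite mulr0 subr0.
  have powE i : (0 < i)%N ->
      \sum_(1 <= a < d) a%:R ^+ i = trapezoid i d - 2^-1 * d%:R ^+ i :> F.
    by move=> i0; rewrite trapezoidE// addrK.
  transitivity (d%:R ^+ n * (d%:R * \sum_(1 <= a < d) a%:R ^+ 1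
      - \sum_(1 <= a < d) a%:R ^+ 2)
    - d%:R * (d%:R * \sum_(1 <= a < d) a%:R ^+ n - \sum_(1 <= a < d) a%:R ^+ n.+1)
    - d%:R * (d%:R * \sum_(1 <= a < d) (d%:R - a%:R) ^+ n
       - \sum_(1 <= a < d) (d%:R - a%:R) ^+ n.+1) : F).
    rewrite !mulr_sumr -!sumrB !mulr_sumr -!sumrB; apply: eq_bigr => a _.
    by rewrite /h [a%:R + _]addrC subrK !exprS expr0; ring.
  rewrite !sum_rev_pow !powE// /f /T /c !exprS expr0.
  have : n.+1%:R != 0 :> F by rewrite pnatr_eq0.
  have : n.+2%:R != 0 :> F by rewrite pnatr_eq0.
  move: (n.+1%:R) (n.+2%:R) => m m' m0 m'0; field.
  by rewrite m0 m'0.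
by move=> ->; rewrite mulN1r addrC addKr mulKf.
Qed.

Lemma subalg_divisor_seq : A (@divisor_seq F 1) -> A (@divisor_seq F 3) ->
  A (@divisor_seq F 5) -> forall j, odd j -> A (@divisor_seq F j).
Proof.
move=> A1 A3 A5; elim/ltn_ind => -[|[|[|[|[|[|[|m]]]]]]] IHj oj //.
apply: subalg_divisor_seq_step => [|//|j oj' /IHj]; last exact.
by move: oj; rewrite /= !negbK.
Qed.

End EisensteinRelations.

(** * Complex sequences and their moduli *)

Section Modulus.
Variable R : realType.
Implicit Types (z w : R[i]) (x y : R).

(** The modulus as a real number; the norm of [R[i]] takes its values in
    [R[i]]. *)
Definition modulus z : R := complex.Re `|z|.

Lemma normE z : `|z| = (modulus z)%:C%C.
Proof. by rewrite /modulus normc_def. Qed.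

Lemma modulusE z : modulus z = Num.sqrt (complex.Re z ^+ 2 + complex.Im z ^+ 2).
Proof. by rewrite /modulus normc_def. Qed.

Lemma modulus_ge0 z : 0 <= modulus z.
Proof. by rewrite modulusE sqrtr_ge0. Qed.

Lemma modulus0 : modulus 0 = 0.
Proof. by rewrite /modulus normr0. Qed.

Lemma modulus_eq0 z : modulus z = 0 -> z = 0.
Proof. by move=> z0; apply/normr0_eq0; rewrite normE z0. Qed.

Lemma modulusN z : modulus (- z) = modulus z.
Proof. by rewrite /modulus normrN. Qed.

Lemma modulusM z w : modulus (z * w) = modulus z * modulus w.
Proof. by apply: (@complexI R); rewrite rmorphM -!normE normrM. Qed.

Lemma modulusX z n : modulus (z ^+ n) = modulus z ^+ n.
Proof. by apply: (@complexI R); rewrite rmorphXn -!normE normrX. Qed.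

Lemma modulusV z : modulus z^-1 = (modulus z)^-1.
Proof. by apply: (@complexI R); rewrite fmorphV -!normE normfV. Qed.

Lemma modulusD z w : modulus (z + w) <= modulus z + modulus w.
Proof. by rewrite -lecR rmorphD/= -!normE ler_normD. Qed.

Lemma modulus_sum I (r : seq I) (P : pred I) (F : I -> R[i]) :
  modulus (\sum_(i <- r | P i) F i) <= \sum_(i <- r | P i) modulus (F i).
Proof.
elim/big_rec2: _ => [|i y z _ le_zy]; first by rewrite modulus0.
by apply: le_trans (modulusD _ _) _; rewrite lerD2l.
Qed.

Lemma modulus_real x : modulus x%:C%C = `|x|.
Proof. by rewrite modulusE /= expr0n/= addr0 sqrtr_sqr. Qed.

Lemma modulus_nat n : modulus n%:R = n%:R.
Proof. by rewrite -[n%:R](rmorph_nat (real_complex R)) modulus_real ger0_norm. Qed.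

Lemma Re_modulus z : `|complex.Re z| <= modulus z.
Proof. by rewrite modulusE -sqrtr_sqr ler_sqrt// ?lerDl ?addr_ge0 ?sqr_ge0. Qed.

Lemma Im_modulus z : `|complex.Im z| <= modulus z.
Proof. by rewrite modulusE -sqrtr_sqr ler_sqrt// ?lerDr ?addr_ge0 ?sqr_ge0. Qed.

Lemma modulus_ReIm z : modulus z <= `|complex.Re z| + `|complex.Im z|.
Proof.
rewrite modulusE -[leRHS]ger0_norm ?addr_ge0// -sqrtr_sqr ler_sqrt ?sqr_ge0//.
rewrite sqrrD !real_normK ?num_real// lerD2r lerDl.
by rewrite mulrn_wge0// mulr_ge0.
Qed.

Local Notation C := (R[i]^o).

Lemma cvg_modulus (u : nat -> C) (l : C) (v : nat -> R) :
  (forall n, modulus (l - u n) <= v n) -> v @ \oo --> 0 -> u @ \oo --> l.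
Proof.
move=> uv v0; apply/cvgrPdist_le => e e0.
have eE : e = (complex.Re e)%:C%C by rewrite RRe_real// gtr0_real.
have Re0 : 0 < complex.Re e by rewrite -ltcR -eE.
near=> n; rewrite normE eE lecR; apply: le_trans (uv n) _.
suff : `|v n| <= complex.Re e by apply: le_trans; exact: ler_norm.
by near: n; exact: (cvgr0_norm_le _ v0 _ Re0).
Unshelve. all: by end_near. Qed.

Lemma cvg_modulus_near (u : nat -> C) (l : C) (e : R) : u @ \oo --> l -> 0 < e ->
  exists N, forall n, (N <= n)%N -> modulus (l - u n) <= e.
Proof.
move=> ul e0; have e0' : 0 < e%:C%C :> R[i] by rewrite ltcR.
move/cvgrPdist_le : ul => /(_ _ e0')[N _ NP].
by exists N => n Nn; rewrite -lecR -normE; apply: NP.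
Qed.

Lemma modulus_lim_le (u : nat -> C) (l : C) (B : R) : u @ \oo --> l ->
  (forall n, modulus (u n) <= B) -> modulus l <= B.
Proof.
move=> ul uB; apply/ler_addgt0Pr => e e0.
have [N NP] := cvg_modulus_near ul e0.
rewrite -[l](subrK (u N)) addrC; apply: le_trans (modulusD _ _) _.
by apply: lerD => //; apply: NP.
Qed.

(** Completeness is inherited from the real line through real and imaginary
    parts. *)
Lemma cvg_series_modulus (c : nat -> C) (v : nat -> R) :
  (forall n, modulus (c n) <= v n) -> cvgn (series v) ->
  exists l : C, series c @ \oo --> l.
Proof.
move=> cv vcvg; have v0 n : 0 <= v n by apply: le_trans (cv n); exact: modulus_ge0.
pose re n : R := complex.Re (c n); pose im n : R := complex.Im (c n).
have cvg_part (p : nat -> R) : (forall n, `|p n| <= modulus (c n)) -> cvgn (series p).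
  move=> pc; apply: normed_cvg; apply: (@series_le_cvg _ _ v) => [n|n|n|] //=.
  exact: le_trans (pc n) (cv n).
have /cvg_ex[/= a ra] := cvg_part re (fun n => Re_modulus _).
have /cvg_ex[/= b ib] := cvg_part im (fun n => Im_modulus _).
exists (a +i* b)%C.
apply: (cvg_modulus (v := fun n => `|a - series re n| + `|b - series im n|)).
  move=> n; have -> : series c n = (series re n +i* series im n)%C.
    elim: n => [|n IHn]; first by rewrite /series/= !big_geq.
    by rewrite !seriesSr IHn /re /im; case: (c n).
  exact: modulus_ReIm.
have cvg_dist (p : nat -> R) (x : R) : p @ \oo --> x ->
    (fun n => `|x - p n|) @ \oo --> (0 : R).
  move=> px; have := cvg_norm (cvgB (cvg_cst x) px).
  by rewrite subrr normr0; exact.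
by rewrite -[0 : R]addr0; apply: cvgD; apply: cvg_dist.
Qed.

Lemma cvg_unique_complex (u : nat -> C) (l l' : C) :
  u @ \oo --> l -> u @ \oo --> l' -> l = l'.
Proof. by move=> ul ul'; apply: (cvg_unique _ ul ul'); exact: norm_hausdorff. Qed.

Lemma sum_expr_le (s : R) N : 0 <= s < 1 -> \sum_(0 <= n < N) s ^+ n <= (1 - s)^-1.
Proof.
move=> /andP[s0 s1]; have s10 : 0 < 1 - s by rewrite subr_gt0.
suff -> : \sum_(0 <= n < N) s ^+ n = (1 - s ^+ N) / (1 - s).
  by rewrite ler_piMl ?invr_ge0 ?(ltW s10)// gerBl exprn_ge0.
elim: N => [|N IHN]; first by rewrite big_geq// expr0 subrr mul0r.
rewrite big_nat_recr//= IHN exprS; field.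
by rewrite gt_eqF.
Qed.
End Modulus.

(** * Second-order estimate of the complex exponential *)

Section ComplexExponential.
Variable R : realType.
Implicit Types (z w : R[i]) (x y : R).

(** The mean value theorem for [sin] on [0, y]; since the slope is a cosine
    again, it yields the first- and second-order bounds below. *)
Lemma sin_mean_value y : exists2 c, `|c| <= `|y| & sin y = y * cos c.
Proof.
wlog y0 : y / 0 <= y => [hw|].
  have [/hw//|/ltW y0] := leP 0 y.
  have [|c cy e] := hw (- y); first by rewrite oppr_ge0.
  exists c; first by rewrite -(normrN y).
  by rewrite -[LHS]opprK -sinN e mulNr opprK.
have sin' x : x \in `]0, y[ -> is_derive x 1 (@sin R) (cos x).
  by move=> _; exact: is_derive_sin.
have sin_cont : {within `[0, y], continuous (@sin R)}.
  by apply: continuous_subspaceT => x; exact: continuous_sin.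
have [c] := MVT_segment y0 sin' sin_cont.
rewrite in_itv/= sin0 !subr0 => /andP[c0 cy] ->.
by exists c; [rewrite !ger0_norm|rewrite mulrC].
Qed.

Lemma norm_sin_le y : `|sin y| <= `|y|.
Proof.
have [c _ ->] := sin_mean_value y.
by rewrite normrM ler_piMr// cos_max.
Qed.

Lemma cosB1 y : cos y - 1 = - 2 * sin (y / 2) ^+ 2.
Proof.
have -> : cos y = cos ((y / 2) *+ 2) by rewrite -mulr_natr divfK.
rewrite cos_mulr2n cos2sin2 -mulr_natr; ring.
Qed.

Lemma norm_cosB1 y : `|cos y - 1| = 2 * `|sin (y / 2)| ^+ 2.
Proof. by rewrite cosB1 mulNr normrN normrM normrX normr_nat. Qed.

Lemma norm_cosB1_le1 y : `|cos y - 1| <= `|y|.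
Proof.
rewrite norm_cosB1.
have h : `|sin (y / 2)| <= `|y| / 2.
  by apply: le_trans (norm_sin_le _) _; rewrite normrM [X in _ * X]ger0_norm.
have := sin_max (y / 2); have := normr_ge0 (sin (y / 2)).
by move: h; set s := `|sin _|; nra.
Qed.

Lemma norm_cosB1_le2 y : `|cos y - 1| <= `|y| ^+ 2.
Proof.
rewrite norm_cosB1.
have h : `|sin (y / 2)| <= `|y| / 2.
  by apply: le_trans (norm_sin_le _) _; rewrite normrM [X in _ * X]ger0_norm.
have := normr_ge0 (sin (y / 2)).
by move: h; set s := `|sin _|; nra.
Qed.

Lemma norm_sinB_le y : `|sin y - y| <= `|y| ^+ 2.
Proof.
have [c cy ->] := sin_mean_value y.
rewrite -[X in _ - X]mulr1 -mulrBr normrM expr2 ler_wpM2l//.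
exact: le_trans (norm_cosB1_le1 c) cy.
Qed.

Lemma norm_expRB1_le x : `|expR x - 1| <= `|x| * expR `|x|.
Proof.
have h1 := expR_ge1Dx x; have h2 := expR_ge1Dx (- x).
have h3 := expRxMexpNx_1 x; have h4 := expR_gt0 x; have h5 := expR_gt0 (- x).
have [x0|x0] := leP 0 x.
  rewrite [`|x|]ger0_norm// ger0_norm; last by lra.
  by nra.
rewrite [`|x|]ltr0_norm// ler0_norm; last first.
  by rewrite subr_le0 ltW// expR_lt1.
have : 1 <= expR (- x) by lra.
by nra.
Qed.

Lemma norm_expRB1B_le x : `|expR x - 1 - x| <= `|x| ^+ 2 * expR `|x|.
Proof.
have h1 := expR_ge1Dx x; have h2 := expR_ge1Dx (- x).
have h3 := expRxMexpNx_1 x; have h4 := expR_gt0 x.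
rewrite ger0_norm; last by lra.
apply: (@le_trans _ _ (`|x| * `|expR x - 1|)); last first.
  by rewrite expr2 -mulrA ler_wpM2l// norm_expRB1_le.
rewrite -normrM; apply: le_trans (ler_norm _).
have : expR x * (1 + - x) <= 1 by rewrite -[leRHS]h3 ler_wpM2l// ltW.
by nra.
Qed.

Lemma modulus_cexp w : modulus (cexp w) = expR (complex.Re w).
Proof.
rewrite modulusE /= !exprMn -mulrDr cos2Dsin2 mulr1 sqrtr_sqr.
by rewrite ger0_norm ?expR_ge0.
Qed.

Lemma cexpD z w : cexp (z + w) = cexp z * cexp w.
Proof.
case: z w => [a b] [c d]; rewrite /cexp /= expRD cosD sinD.
by apply/eqP; rewrite eq_complex /=; apply/andP; split; apply/eqP; ring.
Qed.

Lemma cexp0 : cexp 0 = 1 :> R[i].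
Proof. by rewrite /cexp /= expR0 cos0 sin0 mulr1 mulr0. Qed.

Lemma cexpMn w n : cexp (n%:R * w) = cexp w ^+ n.
Proof.
elim: n => [|n IHn]; first by rewrite mul0r cexp0 expr0.
by rewrite -natr1 mulrDl mul1r cexpD IHn exprSr.
Qed.

(** The bound is uniform in [w], which allows a [q]-series to be differentiated
    term by term. *)
Lemma modulus_cexpB1B_le w :
  modulus (cexp w - 1 - w) <= 4 * (modulus w ^+ 2 * expR (modulus w)).
Proof.
have := Re_modulus w; have := Im_modulus w.
have := modulus_ge0 w; move: (modulus w) => A A0; case: w => x y /= yA xA.
apply: le_trans (modulus_ReIm _) _ => /=; rewrite !subr0.
have e1 : 1 <= expR A by rewrite -expR0 ler_expR.
have exA : expR x <= expR A by rewrite ler_expR (le_trans (ler_norm _)).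
have e2 : expR `|x| <= expR A by rewrite ler_expR.
have e0 := expR_gt0 x; have e00 := expR_gt0 `|x|.
have yy : `|y| ^+ 2 <= A ^+ 2 by rewrite lerXn2r ?nnegrE.
have xx : `|x| ^+ 2 <= A ^+ 2 by rewrite lerXn2r ?nnegrE.
have A2 : 0 <= A ^+ 2 by rewrite exprn_ge0.
have b1 : `|expR x * cos y - 1 - x| <= A ^+ 2 * expR A + A ^+ 2 * expR A.
  have -> : expR x * cos y - 1 - x = expR x * (cos y - 1) + (expR x - 1 - x) by ring.
  apply: le_trans (ler_normD _ _) _; apply: lerD.
    rewrite normrM [`|expR x|]ger0_norm ?(ltW e0)// [leLHS]mulrC.
    apply: ler_pM => //.
    exact: le_trans (norm_cosB1_le2 _) yy.
  apply: le_trans (norm_expRB1B_le _) _; apply: ler_pM => //; exact: ltW.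
have b2 : `|expR x * sin y - y| <= A ^+ 2 * expR A + A ^+ 2 * expR A.
  have -> : expR x * sin y - y = (expR x - 1) * sin y + (sin y - y) by ring.
  apply: le_trans (ler_normD _ _) _; apply: lerD.
    rewrite normrM expr2 -mulrA [leLHS]mulrC.
    apply: ler_pM => //; first exact: le_trans (norm_sin_le _) yA.
    apply: le_trans (norm_expRB1_le _) _; apply: ler_pM => //; exact: ltW.
  apply: le_trans (norm_sinB_le _) _; apply: le_trans yy _.
  by rewrite ler_peMr.
by move: b1 b2; lra.
Qed.

End ComplexExponential.

(** * Geometric bounds *)

Section GeometricBounds.
Variable R : realType.

Lemma natr_expr_bounded (s : R) : 0 <= s < 1 ->
  exists2 K, 0 <= K & forall n, n%:R * s ^+ n <= K.
Proof.
move=> /andP[]; rewrite le_eqVlt => /predU1P[<- _|s0 s1].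
  by exists 0 => // -[|n]; rewrite ?mul0r// expr0n mulr0.
have bern n : 1 + n%:R * (s^-1 - 1) <= s^-1 ^+ n.
  elim: n => [|n IHn]; first by rewrite mul0r addr0 expr0.
  have sV : 0 <= s^-1 - 1 by rewrite subr_ge0 invf_ge1// ltW.
  rewrite exprS -natr1; move: IHn sV; set x := s^-1 => IHn sV.
  have : x * (1 + n%:R * (x - 1)) <= x * x ^+ n by rewrite ler_wpM2l// /x invr_ge0 ltW.
  have : 0 <= n%:R * (x - 1) ^+ 2 by rewrite mulr_ge0// sqr_ge0.
  move: (x ^+ n) (n%:R) => y m; nra.
have sV : 0 < s^-1 - 1 by rewrite subr_gt0 invf_gt1.
exists (s^-1 - 1)^-1; first by rewrite invr_ge0 ltW.
move=> n; have sn : 0 < s ^+ n by rewrite exprn_gt0.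
rewrite -[leRHS]mul1r ler_pdivlMr// (_ : s ^+ n = (s^-1 ^+ n)^-1); last first.
  by rewrite exprVn invrK.
rewrite mulrAC ler_pdivrMr ?exprn_gt0 ?invr_gt0// mul1r.
by apply: le_trans (bern n); rewrite lerDr.
Qed.

Lemma natrX_expr_geometric k (s : R) : 0 <= s < 1 ->
  exists K t, [/\ 0 <= K, 0 <= t < 1 & forall n, n%:R ^+ k * s ^+ n <= K * t ^+ n].
Proof.
elim: k => [|k IHk] s01; first by exists 1, s; split => // n; rewrite expr0 !mul1r.
have [K [t [K0 t01 Kt]]] := IHk s01; have /andP[t0 t1] := t01.
pose u := (t + 1) / 2.
have u0 : 0 < u by rewrite /u; lra.
have u1 : u < 1 by rewrite /u; lra.
have tu : 0 <= t / u < 1.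
  by rewrite divr_ge0 ?(ltW u0)//= ltr_pdivrMr// mul1r /u; lra.
have [L L0 Lt] := natr_expr_bounded tu.
exists (K * L), u; rewrite (ltW u0) u1 mulr_ge0//; split => // n.
rewrite exprS -mulrA; apply: (@le_trans _ _ (n%:R * (K * t ^+ n))).
  by rewrite ler_wpM2l.
have -> : n%:R * (K * t ^+ n) = K * (n%:R * (t / u) ^+ n * u ^+ n).
  by rewrite exprMn exprVn -!mulrA mulVf ?mulr1 1?mulrCA// expf_neq0// gt_eqF.
by rewrite -[leRHS]mulrA ler_wpM2l// ler_wpM2r ?Lt// exprn_ge0// ltW.
Qed.

Lemma cvg_natrX_expr k (s : R) : 0 <= s < 1 ->
  (fun n => n%:R ^+ k * s ^+ n) @ \oo --> (0 : R).
Proof.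
move=> s01; have [K [t [K0 /andP[t0 t1] Kt]]] := natrX_expr_geometric k s01.
have /andP[s0 s1] := s01.
apply: (@squeeze_cvgr _ _ _ _ (fun=> 0) (geometric K t)).
- by apply: nearW => n; rewrite mulr_ge0 ?exprn_ge0//=.
- exact: cvg_cst.
- by apply: cvg_geometric; rewrite ger0_norm.
Qed.

End GeometricBounds.

(** * q-expansions *)

Section QExpansions.
Variable R : realType.
Local Notation C := (R[i]^o).
Local Notation form := (uhp R -> C).
Implicit Types (f g : form) (b c : nat -> C) (tau : uhp R) (r : R).

Lemma two_pi_i_neq0 : two_pi_i R != 0.
Proof. by rewrite eq_complex /= eqxx mulf_neq0 ?gt_eqF ?pi_gt0. Qed.

Lemma modulus_two_pi_i : modulus (two_pi_i R) = 2 * pi.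
Proof.
by rewrite modulusE /= expr0n/= add0r sqrtr_sqr ger0_norm// mulr_ge0// pi_ge0.
Qed.

Lemma Re_two_pi_iM (z : R[i]) :
  complex.Re (two_pi_i R * z) = - (2 * pi * complex.Im z).
Proof. by case: z => x y /=; rewrite mul0r sub0r. Qed.

Lemma modulus_q tau : modulus (q tau) = expR (- (2 * pi * complex.Im (val tau))).
Proof. by rewrite modulus_cexp Re_two_pi_iM. Qed.

Lemma modulus_q_lt1 tau : 0 <= modulus (q tau) < 1.
Proof.
rewrite modulus_ge0 modulus_q expR_lt1 oppr_lt0 mulr_gt0 ?mulr_gt0 ?pi_gt0//.
exact: (valP tau).
Qed.

(** Points of the imaginary axis; they suffice to recover the growth and the
    values of the coefficients of a [q]-expansion. *)
Lemma q_real r : 0 < r < 1 -> exists tau, q tau = r%:C%C.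
Proof.
move=> /andP[r0 r1]; pose y : R := - ln r / (2 * pi).
have y0 : 0 < complex.Im (0 +i* y)%C.
  by rewrite divr_gt0 ?mulr_gt0 ?pi_gt0// oppr_gt0 ln_lt0// r0.
exists (exist _ (0 +i* y)%C y0); rewrite /q /=.
have -> : two_pi_i R * (0 +i* y)%C = (ln r)%:C%C.
  apply/eqP; rewrite eq_complex /=; apply/andP; split; apply/eqP; last by ring.
  rewrite mul0r sub0r.
  by rewrite /y mulNr mulrN opprK mulrC divfK// gt_eqF// mulr_gt0// pi_gt0.
by rewrite /cexp /= cos0 sin0 mulr1 mulr0 lnK.
Qed.

(** Growth condition expressing that the power series of [b] converges on the
    open unit disc. *)
Definition tame b := forall r, 0 <= r < 1 ->
  exists M, forall n, modulus (b n) * r ^+ n <= M.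

Lemma q_expansion_tame f b : q_expansion f b -> tame b.
Proof.
move=> fb r /andP[r0 r1]; pose s := (r + 1) / 2.
have s01 : 0 < s < 1 by rewrite /s; apply/andP; split; lra.
have [tau qE] := q_real s01.
have [N NP] := cvg_modulus_near (fb tau) ltr01.
pose u n := b n * q tau ^+ n.
have uE n : modulus (u n) = modulus (b n) * s ^+ n.
  by rewrite modulusM modulusX qE modulus_real ger0_norm//; case/andP: s01 => /ltW.
exists (2 + \sum_(i < N) modulus (u i)) => n.
apply: (@le_trans _ _ (modulus (u n))).
  rewrite uE ler_wpM2l ?modulus_ge0// lerXn2r ?nnegrE//; rewrite /s; lra.
have [nN|Nn] := ltnP n N.
  rewrite (bigD1 (Ordinal nN))//= addrCA lerDl addr_ge0// sumr_ge0// => i _.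
  exact: modulus_ge0.
have -> : u n = (f tau - series u n) - (f tau - series u n.+1).
  by rewrite seriesSr; ring.
apply: le_trans (modulusD _ _) _; rewrite modulusN.
have h1 := NP n Nn; have h2 := NP n.+1 (leqW Nn).
have : 0 <= \sum_(i < N) modulus (u i) by apply: sumr_ge0 => i _; exact: modulus_ge0.
by move: h1 h2; rewrite -/u; lra.
Qed.

Lemma tame_geometric b k r : tame b -> 0 <= r < 1 ->
  exists K t, [/\ 0 <= K, 0 <= t < 1 &
    forall n, n%:R ^+ k * modulus (b n) * r ^+ n <= K * t ^+ n].
Proof.
move=> tb /andP[r0 r1]; pose s := (r + 1) / 2.
have s0 : 0 < s by rewrite /s; lra.
have s1 : s < 1 by rewrite /s; lra.
have rs : 0 <= r / s < 1.
  by rewrite divr_ge0 ?(ltW s0)//= ltr_pdivrMr// mul1r /s; lra.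
have [M bM] : exists M, forall n, modulus (b n) * s ^+ n <= M.
  by apply: tb; rewrite ltW.
have M0 : 0 <= M by apply: le_trans (bM 0%N); rewrite expr0 mulr1 modulus_ge0.
have [K [t [K0 t01 Kt]]] := natrX_expr_geometric k rs.
exists (K * M), t; split => //; first by rewrite mulr_ge0.
move=> n; have -> : n%:R ^+ k * modulus (b n) * r ^+ n =
    (n%:R ^+ k * (r / s) ^+ n) * (modulus (b n) * s ^+ n).
  by rewrite -{1}(divfK (lt0r_neq0 s0) r) exprMn; ring.
have /andP[t0 t1] := t01; have /andP[rs0 _] := rs.
rewrite [leRHS]mulrAC; apply: ler_pM => //.
  by rewrite mulr_ge0 ?exprn_ge0.
by rewrite mulr_ge0 ?modulus_ge0 ?exprn_ge0// ltW.
Qed.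

Lemma tame_cvg b : tame b -> exists f, q_expansion f b.
Proof.
move=> tb; exists (fun tau => lim (series (fun n => b n * q tau ^+ n) @ \oo)) => tau.
have [K [t [K0 /andP[t0 t1] Kt]]] := tame_geometric 0 tb (modulus_q_lt1 tau).
have [l /cvgP//] : exists l : C, series (fun n => b n * q tau ^+ n) @ \oo --> l.
apply: (cvg_series_modulus (v := geometric K t)) => [n|].
  by have := Kt n; rewrite expr0 mul1r modulusM modulusX.
by apply: is_cvg_geometric_series; rewrite ger0_norm.
Qed.

Lemma tame_theta b : tame b -> tame (theta b).
Proof.
move=> tb r r01; have [K [t [K0 /andP[t0 t1] Kt]]] := tame_geometric 1 tb r01.
exists K => n; rewrite modulusM modulus_nat -[n%:R]expr1; apply: le_trans (Kt n) _.
by rewrite ler_piMr// exprn_ile1// ltW.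
Qed.

Lemma tame_divisor_seq j : tame (@divisor_seq R[i] j).
Proof.
move=> r r01; have [K [t [K0 /andP[t0 t1] Kt]]] := natrX_expr_geometric j.+1 r01.
have /andP[r0 r1] := r01.
exists K => n; apply: (@le_trans _ _ (n%:R ^+ j.+1 * r ^+ n)); last first.
  by apply: le_trans (Kt n) _; rewrite ler_piMr// exprn_ile1// ltW.
rewrite ler_wpM2r ?exprn_ge0//; apply: le_trans (modulus_sum _ _ _) _.
apply: (@le_trans _ _ (\sum_(d <- divs n) n%:R ^+ j)).
  rewrite big_seq [leRHS]big_seq; apply: ler_sum => d.
  rewrite mem_divs => /andP[n0 dn]; rewrite modulusX modulus_nat.
  by rewrite lerXn2r ?nnegrE ?ler_nat// dvdn_leq.
rewrite big_const_seq count_predT iter_addr_0 exprS -[_ *+ size _]mulr_natl.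
rewrite ler_wpM2r ?exprn_ge0// ler_nat -[leqRHS](size_iota 1); apply: uniq_leq_size.
  exact: divs_uniq.
move=> d; rewrite mem_divs mem_iota add1n ltnS => /andP[n0 dn].
by rewrite (dvdn_gt0 n0 dn) dvdn_leq.
Qed.

Lemma q_expansion_cst (c : C) : q_expansion (fun=> c) (fun n => c * (n == 0%N)%:R).
Proof.
move=> tau; apply: (cvg_modulus (v := fun n => modulus c * (n == 0%N)%:R)) => [n|].
  case: n => [|n]; first by rewrite /series/= big_geq// subr0 mulr1.
  rewrite /series/= big_ltn// big1_seq => [|i].
    by rewrite addr0 expr0 !mulr1 subrr modulus0 mulr0.
  by rewrite mem_index_iota => /andP[_ /andP[i0 _]]; rewrite gtn_eqF// mulr0 mul0r.
rewrite -(cvg_shiftS (fun n => modulus c * (n == 0%N)%:R)) /=.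
rewrite mulr0; exact: cvg_cst.
Qed.

Lemma q_expansionD f g b c : q_expansion f b -> q_expansion g c ->
  q_expansion (f + g) (fun n => b n + c n).
Proof.
move=> fb gc tau.
rewrite (_ : (fun n => _) = (fun n => b n * q tau ^+ n) + (fun n => c n * q tau ^+ n)).
  by rewrite seriesD; apply: cvgD.
by apply/funext => n; rewrite mulrDl.
Qed.

Lemma q_expansionZ (a : C) f b : q_expansion f b ->
  q_expansion (a *: f) (fun n => a * b n).
Proof.
move=> fb tau.
rewrite (_ : (fun n => _) = a *: (fun n => b n * q tau ^+ n)).
  by rewrite seriesZ; apply: cvgZl_tmp.
by apply/funext => n; rewrite -mulrA.
Qed.

Lemma sum_triangle (F : nat -> nat -> C) N :
  \sum_(0 <= m < N) \sum_(0 <= i < m.+1) F i (m - i)%N =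
  \sum_(0 <= i < N) \sum_(0 <= j < N - i) F i j.
Proof.
elim: N => [|N IHN]; first by rewrite !big_geq.
rewrite big_nat_recr//= IHN [in RHS]big_nat_recr//= subSnn big_nat1.
rewrite [X in _ + X = _]big_nat_recr//= subnn addrA -big_split/=; congr (_ + _).
apply: eq_big_nat => i /andP[_ iN].
by rewrite subSn 1?ltnW// [in RHS]big_nat_recr.
Qed.

Lemma cvg_sub0_trans (S T : nat -> C) (l : C) :
  (fun n => T n - S n) @ \oo --> (0 : C) -> S @ \oo --> l -> T @ \oo --> l.
Proof.
move=> TS0 Sl.
have TSS : (fun n => T n - S n) + S = T by apply/funext => n; rewrite [LHS]subrK.
have : ((fun n => T n - S n) + S) @ \oo --> (0 + l : C).
  exact: (@cvgD _ C _ _ _ _ _ _ _ TS0 Sl).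
by rewrite TSS add0r.
Qed.

(** The partial sum of the Cauchy product differs from the product of the
    partial sums by terms of total degree at least [n]; there are at most
    [n ^ 2] of them, each bounded by a multiple of [r ^ n]. *)
Lemma q_expansionM f g b c : q_expansion f b -> q_expansion g c ->
  q_expansion (f * g) (convolution b c).
Proof.
move=> fb gc tau; pose z := q tau.
have z01 := modulus_q_lt1 tau.
have [K [t [K0 t01 Kt]]] := tame_geometric 0 (q_expansion_tame fb) z01.
have [L [s [L0 s01 Ls]]] := tame_geometric 0 (q_expansion_tame gc) z01.
pose r := Num.max t s.
have /andP[t0 t1] := t01; have /andP[s0 s1] := s01.
have r01 : 0 <= r < 1 by rewrite le_max t0 gt_max t1 s1.
have /andP[r0 r1] := r01.
have bK n : modulus (b n * z ^+ n) <= K * r ^+ n.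
  rewrite modulusM modulusX; have := Kt n; rewrite expr0 mul1r => /le_trans; apply.
  by rewrite ler_wpM2l// lerXn2r ?nnegrE// le_max lexx.
have cL n : modulus (c n * z ^+ n) <= L * r ^+ n.
  rewrite modulusM modulusX; have := Ls n; rewrite expr0 mul1r => /le_trans; apply.
  by rewrite ler_wpM2l// lerXn2r ?nnegrE// le_max lexx orbT.
pose S n : C := series (fun n => b n * z ^+ n) n * series (fun n => c n * z ^+ n) n.
pose T n : C := series (fun n => convolution b c n * z ^+ n) n.
have ST n : modulus (S n - T n) <= K * L * (n%:R ^+ 2 * r ^+ n).
  have -> : S n - T n = \sum_(0 <= i < n) \sum_(n - i <= j < n)
      (b i * z ^+ i) * (c j * z ^+ j).
    have -> : T n = \sum_(0 <= i < n) \sum_(0 <= j < n - i)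
        (b i * z ^+ i) * (c j * z ^+ j).
      rewrite -sum_triangle; apply: eq_bigr => m _.
      rewrite /convolution mulr_suml; apply: eq_big_nat => i /andP[_ im].
      have -> : z ^+ m = z ^+ i * z ^+ (m - i) by rewrite -exprD subnKC.
      ring.
    rewrite /S /series /= mulr_suml -sumrB; apply: eq_bigr => i _.
    rewrite mulr_sumr (@big_cat_nat _ _ _ (n - i) 0 n) ?leq_subr//=.
    by rewrite [X in X - _]addrC addrK.
  apply: le_trans (modulus_sum _ _ _) _.
  have -> : K * L * (n%:R ^+ 2 * r ^+ n) =
      \sum_(0 <= i < n) \sum_(0 <= j < n) K * L * r ^+ n.
    rewrite !sumr_const_nat subn0 -!mulrnA -[in LHS]natrX mulr_natl mulrnAr.
    by rewrite expnS expn1.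
  rewrite big_nat [leRHS]big_nat; apply: ler_sum => i /andP[_ iltn].
  apply: le_trans (modulus_sum _ _ _) _.
  rewrite [leRHS](@big_cat_nat _ _ _ (n - i))//= ?leq_subr//.
  apply: ler_wpDl.
    by apply: sumr_ge0 => j _; rewrite !mulr_ge0// exprn_ge0.
  rewrite big_nat [leRHS]big_nat; apply: ler_sum => j /andP[ij _].
  rewrite modulusM; apply: (@le_trans _ _ ((K * r ^+ i) * (L * r ^+ j))).
    by apply: ler_pM; rewrite ?modulus_ge0.
  have -> : K * r ^+ i * (L * r ^+ j) = K * L * r ^+ (i + j) by rewrite exprD; ring.
  rewrite ler_wpM2l ?mulr_ge0// ler_wiXn2l ?(ltW r1)//.
  by rewrite -leq_subLR.
have STlim : (fun n => T n - S n) @ \oo --> (0 : C).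
  apply: (cvg_modulus (v := fun n => K * L * (n%:R ^+ 2 * r ^+ n))).
    by move=> n; rewrite sub0r opprB.
  rewrite -[0 : R](mulr0 (K * L)); apply: cvgM; first exact: cvg_cst.
  exact: cvg_natrX_expr.
have Slim : S @ \oo --> (f tau * g tau : C) by apply: cvgM; [exact: fb|exact: gc].
exact: cvg_sub0_trans STlim Slim.
Qed.

Lemma q_expansion_eq f g b : q_expansion f b -> q_expansion g b -> f = g.
Proof.
by move=> fb gb; apply/funext => tau; apply: cvg_unique_complex (fb tau) (gb tau).
Qed.

(** If [b m] is the first coefficient that is not known to vanish, dividing the
    series by [r ^ m] shows that it is bounded by a multiple of [r], for all
    small [r > 0]. *)
Lemma q_expansion_eq0 b : q_expansion 0 b -> forall n, b n = 0.
Proof.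
move=> b0; elim/ltn_ind => m IHm.
have half01 : 0 <= (2^-1 : R) < 1 by lra.
have [M bM] := q_expansion_tame b0 half01.
have M0 : 0 <= M by apply: le_trans (bM 0%N); rewrite expr0 mulr1 modulus_ge0.
have key r : 0 < r <= 4^-1 -> modulus (b m) <= 2 ^+ m.+2 * M * r.
  move=> /andP[r0 r4]; have r01 : 0 < r < 1 by rewrite r0/=; lra.
  have [tau qE] := q_real r01.
  have lim0 := b0 tau; rewrite -(cvg_shiftn m.+1) in lim0.
  pose u n : C := b n * q tau ^+ n.
  have uE n : modulus (u n) <= M * (2 * r) ^+ n.
    rewrite modulusM modulusX qE modulus_real ger0_norm ?(ltW r0)// exprMn mulrA.
    rewrite ler_wpM2r ?exprn_ge0 ?(ltW r0)//.
    rewrite -ler_pdivrMr ?exprn_gt0// -exprVn; exact: bM.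
  have tail n : modulus (series u (n + m.+1)%N - u m) <= 2 ^+ m.+2 * M * r ^+ m.+1.
    have -> : series u (n + m.+1)%N - u m = \sum_(0 <= i < n) u (i + m.+1)%N.
      have -> : \sum_(0 <= i < n) u (i + m.+1)%N = \sum_(m.+1 <= i < n + m.+1) u i.
        by rewrite -{2}[m.+1]add0n big_addn addnK.
      rewrite series_addn seriesSr.
      have -> : series u m = 0.
        rewrite /series/= big1_seq// => i; rewrite mem_index_iota => /andP[_ im].
        by rewrite /u IHm// mul0r.
      by rewrite add0r addrAC subrr add0r.
    apply: le_trans (modulus_sum _ _ _) _.
    apply: (@le_trans _ _ (\sum_(0 <= i < n) M * (2 * r) ^+ m.+1 * (2 * r) ^+ i)).
      by apply: ler_sum => i _; apply: le_trans (uE _) _; rewrite addnC exprD mulrA.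
    rewrite -mulr_sumr; apply: (@le_trans _ _ (M * (2 * r) ^+ m.+1 * 2)).
      rewrite ler_wpM2l ?mulr_ge0 ?exprn_ge0 ?mulr_ge0 ?(ltW r0)//.
      apply: (@le_trans _ _ (1 - 2 * r)^-1).
        by apply: sum_expr_le; apply/andP; split; lra.
      by rewrite -[leRHS]invrK lef_pV2 ?posrE; lra.
    by rewrite exprMn [2 ^+ m.+2]exprS le_eqVlt; apply/orP; left; apply/eqP; ring.
  have lim1 : (fun n => series u (n + m.+1)%N - u m) @ \oo --> (0 - u m : C).
    exact: (@cvgB _ C _ _ _ _ _ _ _ lim0 (cvg_cst _)).
  have := modulus_lim_le lim1 tail.
  rewrite sub0r modulusN modulusM modulusX qE modulus_real ger0_norm ?(ltW r0)//.
  by rewrite [r ^+ m.+1]exprS mulrA ler_pM2r ?exprn_gt0.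
apply/modulus_eq0/le_anti; rewrite modulus_ge0 andbT.
apply/ler_addgt0Pr => e e0; rewrite add0r.
pose B := 2 ^+ m.+2 * M; have B0 : 0 <= B by rewrite mulr_ge0.
pose r := Num.min 4^-1 (e / (B + 1)).
have B1 : 0 < B + 1 by lra.
have r0 : 0 < r by rewrite lt_min invr_gt0 ltr0n/= divr_gt0.
have := key r; rewrite r0 ge_min lexx => /(_ isT) h; apply: le_trans h _.
rewrite -/B; apply: (@le_trans _ _ (B * (e / (B + 1)))).
  by rewrite ler_wpM2l// ge_min lexx orbT.
by rewrite mulrA ler_pdivrMr// mulrC ler_wpM2l ?(ltW e0)//; lra.
Qed.

Lemma q_expansion_inj f b c : q_expansion f b -> q_expansion f c -> b = c.
Proof.
move=> fb fc; have := q_expansionD fb (q_expansionZ (a := - 1) fc).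
rewrite scaleN1r subrr => /q_expansion_eq0 bc0; apply/funext => n.
by apply/eqP; rewrite -subr_eq0 -(bc0 n) mulN1r.
Qed.

Lemma extendE f tau : extend f (val tau) = f tau.
Proof. by rewrite /extend valK. Qed.

(** Termwise differentiation: the difference between the increment of [f] and
    its expected linear part is the series of
    [b n * q ^ n * (exp (n * w) - 1 - n * w)] with [w = 2 * pi * i * h], which
    [modulus_cexpB1B_le] bounds by a multiple of [h ^ 2]. *)
Lemma q_expansion_D f b : q_expansion f b -> q_expansion (D f) (theta b).
Proof.
move=> fb; have tb := q_expansion_tame fb.
have [g gb] := tame_cvg (tame_theta tb).
suff -> : D f = g by [].
apply/funext => tau; pose z := val tau; pose y := complex.Im z.
have y0 : 0 < y := valP tau.
have piy0 : 0 < pi * y by rewrite mulr_gt0 ?pi_gt0.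
(* [modulus q] is [exp (- 2 * pi * y)], and a step of size at most [y / 2]
   enlarges it at most to [r1 < 1]. *)
pose r1 := expR (- (pi * y)).
have r101 : 0 <= r1 < 1 by rewrite /r1 expR_ge0 expR_lt1 oppr_lt0.
have [K [t [K0 t01 Kt]]] := tame_geometric 2 tb r101.
have /andP[t0 t1] := t01.
pose V := 4 * (2 * pi) ^+ 2 * (K * (1 - t)^-1).
have V0 : 0 <= V.
  by rewrite !mulr_ge0 ?invr_ge0 ?exprn_ge0 ?mulr_ge0 ?pi_ge0// subr_ge0 ltW.
have key h : modulus h <= y / 2 ->
    modulus (extend f (h + z) - f tau - h * two_pi_i R * g tau) <= V * modulus h ^+ 2.
  move=> hy; have hz0 : 0 < complex.Im (h + z).
    rewrite (_ : complex.Im (h + z) = complex.Im h + y); last by rewrite /y; case: (h) (z) => ? ? [].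
    have := Im_modulus h; have := ler_norm (- complex.Im h); rewrite normrN; lra.
  pose tau' : uhp R := exist _ (h + z) hz0.
  have -> : extend f (h + z) = f tau' by rewrite -extendE.
  pose w := two_pi_i R * h.
  have q' : q tau' = q tau * cexp w by rewrite /q /= mulrDr cexpD mulrC.
  have wE : modulus w = 2 * pi * modulus h by rewrite modulusM modulus_two_pi_i.
  pose u n : C := b n * q tau ^+ n * (cexp (n%:R * w) - 1 - n%:R * w).
  have ulim : series u @ \oo --> (f tau' - f tau - h * two_pi_i R * g tau : C).
    pose bq (tau0 : uhp R) : nat -> C := fun n => b n * q tau0 ^+ n.
    pose tq : nat -> C := fun n => theta b n * q tau ^+ n.
    have -> : u = bq tau' - bq tau - (h * two_pi_i R) *: tq.
      apply/funext => n; rewrite /u cexpMn /bq /tq /theta.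
      rewrite -[LHS]/(b n * q tau ^+ n * (cexp w ^+ n - 1 - n%:R * w)).
      rewrite -[RHS]/(b n * q tau' ^+ n - b n * q tau ^+ n
        - (h * two_pi_i R) * (n%:R * b n * q tau ^+ n)).
      by rewrite q' exprMn /w; ring.
    rewrite !(seriesD, seriesN) seriesZ.
    apply: (@cvgB _ C _ _ _ _ _ _ _ (@cvgB _ C _ _ _ _ _ _ _ (fb tau') (fb tau))).
    by apply: cvgZl_tmp; exact: gb.
  apply: (modulus_lim_le ulim) => N; apply: le_trans (modulus_sum _ _ _) _.
  have un n : modulus (u n) <= 4 * modulus w ^+ 2 * (K * t ^+ n).
    rewrite /u modulusM modulusM modulusX.
    apply: (@le_trans _ _ (modulus (b n) * modulus (q tau) ^+ n *
       (4 * (modulus (n%:R * w) ^+ 2 * expR (modulus (n%:R * w)))))).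
      by rewrite ler_wpM2l ?modulus_cexpB1B_le// mulr_ge0 ?exprn_ge0 ?modulus_ge0.
    rewrite modulusM modulus_nat expRM_natl.
    rewrite [leLHS](_ : _ = 4 * modulus w ^+ 2 * (n%:R ^+ 2 * modulus (b n) *
       (modulus (q tau) * expR (modulus w)) ^+ n)); last first.
      by rewrite !exprMn; ring.
    rewrite ler_wpM2l ?mulr_ge0 ?exprn_ge0 ?modulus_ge0//.
    apply: le_trans (Kt n); rewrite ler_wpM2l ?mulr_ge0 ?exprn_ge0 ?modulus_ge0//.
    rewrite lerXn2r ?nnegrE ?mulr_ge0 ?modulus_ge0 ?expR_ge0//.
    rewrite modulus_q -expRD ler_expR wE -/z -/y.
    have := ler_wpM2l (ltW (pi_gt0 R)) hy; lra.
  apply: (@le_trans _ _ (\sum_(0 <= n < N) 4 * modulus w ^+ 2 * (K * t ^+ n))).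
    exact: ler_sum.
  rewrite -!mulr_sumr wE exprMn.
  rewrite [leRHS](_ : _ = 4 * ((2 * pi) ^+ 2 * modulus h ^+ 2) * (K * (1 - t)^-1)); last first.
    by rewrite /V; ring.
  rewrite ler_wpM2l ?mulr_ge0 ?exprn_ge0 ?mulr_ge0 ?pi_ge0 ?modulus_ge0//.
  by rewrite ler_wpM2l// sum_expr_le.
suff dE : derive1 (extend f) z = two_pi_i R * g tau.
  by rewrite /D dE mulKf// two_pi_i_neq0.
apply: cvg_lim; first exact: norm_hausdorff.
apply/cvgrPdist_le => e e0.
have eE : e = (complex.Re e)%:C%C by rewrite RRe_real// gtr0_real.
have Re0 : 0 < complex.Re e by rewrite -ltcR -eE.
pose d := Num.min (y / 2) (complex.Re e / (V + 1)).
have V1 : 0 < V + 1 by lra.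
have d0 : 0 < d by rewrite lt_min !divr_gt0.
have d0' : 0 < d%:C%C :> R[i] by rewrite ltcR.
near=> h.
have h0 : h != 0 by near: h; exact: nbhs_dnbhs_neq.
have hd : modulus h <= d.
  by rewrite -lecR -normE; near: h; apply: dnbhs0_le.
have hy : modulus h <= y / 2 by apply: le_trans hd _; rewrite ge_min lexx.
have he : modulus h <= complex.Re e / (V + 1).
  by apply: le_trans hd _; rewrite ge_min lexx orbT.
have mh : 0 < modulus h.
  by rewrite lt_neqAle modulus_ge0 andbT eq_sym; apply: contra h0 => /eqP/modulus_eq0 ->.
rewrite normE eE lecR.
have -> : two_pi_i R * g tau - h^-1 *: (extend f (h + z) - extend f z) =
   - (h^-1 * (extend f (h + z) - f tau - h * two_pi_i R * g tau)).
  rewrite [extend f z]extendE -[_ *: _]/(_ * _).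
  rewrite [in RHS]mulrBr -!mulrA mulKf//; ring.
rewrite modulusN modulusM modulusV mulrC ler_pdivrMr//.
apply: le_trans (key h hy) _; rewrite expr2 mulrA ler_wpM2r ?modulus_ge0//.
apply: (@le_trans _ _ (V * (complex.Re e / (V + 1)))); first by rewrite ler_wpM2l.
by rewrite mulrA ler_pdivrMr// mulrC ler_wpM2l ?(ltW Re0)//; lra.
Unshelve. all: by end_near. Qed.

Lemma q_expansion0 : q_expansion (0 : form) (fun=> 0).
Proof.
have := @q_expansion_cst 0; congr q_expansion.
by apply/funext => n; rewrite mul0r.
Qed.

Lemma q_expansionN f b : q_expansion f b -> q_expansion (- f) (fun n => - b n).
Proof.
move=> fb; have := q_expansionZ (a := -1) fb; rewrite scaleN1r; congr q_expansion.
by apply/funext => n; rewrite mulN1r.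
Qed.

Lemma q_expansionB f g b c : q_expansion f b -> q_expansion g c ->
  q_expansion (f - g) (fun n => b n - c n).
Proof.
move=> fb gc; have := q_expansionD fb (q_expansionZ (a := -1) gc).
rewrite scaleN1r; congr q_expansion; apply/funext => n; rewrite mulN1r//.
Qed.

Lemma q_expansion_iterD f b n : q_expansion f b ->
  q_expansion (iter n D f) (fun m => m%:R ^+ n * b m).
Proof.
move=> fb; elim: n => [|n IHn] /=.
  by move: fb; congr q_expansion; apply/funext => m; rewrite expr0 mul1r.
have := q_expansion_D IHn; congr q_expansion; apply/funext => m.
by rewrite /theta exprS mulrA.
Qed.

Definition G_coef (k : nat) (n : nat) : R[i] :=
  - ratr (bernoulli k) / (2 * k)%:R * (n == 0%N)%:R + divisor_seq R[i] k.-1 n.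

Lemma q_expansion_G k : q_expansion (G k) (G_coef k).
Proof.
have [f fS] := tame_cvg (@tame_divisor_seq k.-1).
have -> : G k = (fun=> - ratr (bernoulli k) / (2 * k)%:R) + f.
  apply/funext => tau; congr (_ + _).
  rewrite (_ : (fun N => _) = series (fun n => divisor_seq R[i] k.-1 n * q tau ^+ n)).
    by apply: cvg_lim; [exact: norm_hausdorff|exact: fS].
  apply/funext => -[|N]; first by rewrite /series/= !big_geq.
  rewrite /series/= [in RHS]big_ltn// {1}/divisor_seq big_nil mul0r add0r.
  by apply: eq_big_nat => n /andP[n0 _]; rewrite divisor_seqE.
have := q_expansionD (@q_expansion_cst (- ratr (bernoulli k) / (2 * k)%:R)) fS.
exact.
Qed.

End QExpansions.

(** * The forms H k are quasimodular and detect primes *)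

Section PrimeDetection.
Variable R : realType.
Local Notation C := (R[i]^o).
Local Notation form := (uhp R -> C).

Lemma quasimodularZ (c : C) (f : form) : quasimodular f -> quasimodular (c *: f).
Proof.
move=> qf; rewrite (_ : c *: f = (fun=> c) * f); last by apply/funext.
by apply: quasimodular_mul => //; exact: quasimodular_cst.
Qed.

(** The sequences of coefficients of quasimodular forms. Since a form is
    determined by its coefficients, quasimodularity can be decided on them. *)
Definition quasi_coef (b : nat -> R[i]) : Prop :=
  exists f : form, quasimodular f /\ q_expansion f b.

Lemma quasi_coef_form (f : form) b : quasi_coef b -> q_expansion f b -> quasimodular f.
Proof. by move=> [g [qg gb]] fb; rewrite (q_expansion_eq fb gb). Qed.

Lemma quasi_coefD a b : quasi_coef a -> quasi_coef b -> quasi_coef (fun n => a n + b n).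
Proof.
move=> [f [qf fa]] [g [qg gb]]; exists (f + g); split.
  exact: quasimodular_add.
exact: q_expansionD.
Qed.

Lemma quasi_coefM a b : quasi_coef a -> quasi_coef b -> quasi_coef (convolution a b).
Proof.
move=> [f [qf fa]] [g [qg gb]]; exists (f * g); split.
  exact: quasimodular_mul.
exact: q_expansionM.
Qed.

Lemma quasi_coefZ c a : quasi_coef a -> quasi_coef (fun n => c * a n).
Proof.
move=> [f [qf fa]]; exists (c *: f); split; last exact: q_expansionZ.
exact: quasimodularZ.
Qed.

Lemma quasi_coef_cst (c : R[i]) : quasi_coef (fun n => c * (n == 0%N)%:R).
Proof. by exists (fun=> c); split; [exact: quasimodular_cst|exact: q_expansion_cst]. Qed.

Lemma quasi_coef_divisor_G k : quasimodular (@G R k) -> quasi_coef (divisor_seq R[i] k.-1).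
Proof.
move=> qG; have Gc : quasi_coef (@G_coef R k).
  by exists (G k); split => //; exact: q_expansion_G.
have := quasi_coefD Gc (quasi_coefZ (-1) (quasi_coef_cst (- ratr (bernoulli k) / (2 * k)%:R))).
by congr quasi_coef; apply/funext => n; rewrite /G_coef mulN1r addrC addKr.
Qed.

Lemma quasi_coef_divisor j : odd j -> quasi_coef (divisor_seq R[i] j).
Proof.
apply: subalg_divisor_seq.
- exact: quasi_coefD.
- exact: quasi_coefZ.
- exact: quasi_coefM.
- exact: (@quasi_coef_divisor_G 2 (quasimodular_G2 R)).
- exact: (@quasi_coef_divisor_G 4 (quasimodular_G4 R)).
- exact: (@quasi_coef_divisor_G 6 (quasimodular_G6 R)).
Qed.

Lemma quasimodular_G k : (1 < k)%N -> ~~ odd k -> quasimodular (@G R k).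
Proof.
case: k => [//|k] k1 ek; apply: quasi_coef_form (@q_expansion_G R k.+1).
apply: quasi_coefD; first exact: quasi_coef_cst.
by apply: quasi_coef_divisor; rewrite /= negbK in ek.
Qed.

Lemma theta_convolution (a b : nat -> R[i]) :
  theta (convolution a b) =
  (fun n => convolution (theta a) b n + convolution a (theta b) n).
Proof.
apply/funext => n; rewrite /theta /convolution mulr_sumr -big_split/=.
apply: eq_big_nat => i /andP[_ i_n]; rewrite -{1}(subnKC (m := i) (n := n))// natrD.
ring.
Qed.

Lemma quasi_coef_theta_divisor j : odd j -> quasi_coef (theta (divisor_seq R[i] j)).
Proof.
move=> oj; have := @subalg_theta_divisor_seq R[i] quasi_coef quasi_coefD quasi_coefZ quasi_coefM j.+1.
by apply => [||i oi _]; rewrite ?ltnS ?odd_gt0 //= ?oj//; exact: quasi_coef_divisor.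
Qed.

Lemma quasi_coef_theta_G k : odd k.-1 -> quasi_coef (theta (@G_coef R k)).
Proof.
move=> /quasi_coef_theta_divisor; congr quasi_coef; apply/funext => -[|n].
  by rewrite /theta !mul0r.
by rewrite /theta /G_coef mulr0 add0r.
Qed.

(** [D] is a derivation, so it is enough to differentiate the generators. *)
Lemma quasimodular_theta (f : form) : quasimodular f ->
  exists2 b, q_expansion f b & quasi_coef (theta b).
Proof.
elim=> [c||||{}f g qf [a fa Da] qg [b gb Db]|{}f g qf [a fa Da] qg [b gb Db]].
- exists (fun n => c * (n == 0%N)%:R); first exact: q_expansion_cst.
  have := quasi_coef_cst 0; congr quasi_coef; apply/funext => -[|n].
    by rewrite /theta !mul0r.
  by rewrite /theta !mulr0.
- by exists (G_coef R 2); [exact: q_expansion_G|exact: quasi_coef_theta_G].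
- by exists (G_coef R 4); [exact: q_expansion_G|exact: quasi_coef_theta_G].
- by exists (G_coef R 6); [exact: q_expansion_G|exact: quasi_coef_theta_G].
- exists (fun n => a n + b n); first exact: q_expansionD.
  have := quasi_coefD Da Db; congr quasi_coef; apply/funext => n.
  by rewrite /theta mulrDr.
- exists (convolution a b); first exact: q_expansionM.
  rewrite theta_convolution; apply: quasi_coefD; apply: quasi_coefM => //.
    by exists g.
  by exists f.
Qed.

Lemma quasimodular_D (f : form) : quasimodular f -> quasimodular (D f).
Proof.
move=> /quasimodular_theta[b fb qb]; apply: quasi_coef_form qb _.
exact: q_expansion_D.
Qed.

Lemma quasimodular_iterD (f : form) n : quasimodular f -> quasimodular (iter n D f).
Proof. by move=> qf; elim: n => //= n; exact: quasimodular_D. Qed.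

Lemma quasimodularN (f : form) : quasimodular f -> quasimodular (- f).
Proof. by rewrite -scaleN1r; exact: quasimodularZ. Qed.

Lemma quasimodular_H k : (6 <= k)%N -> ~~ odd k -> quasimodular (@H R k).
Proof.
move=> k6 ek; have qG := quasimodular_G; rewrite /H.
have [k6'|k6'] := eqVneq k 6%N.
  apply: quasimodularZ; apply: quasimodular_add; last by apply: quasimodularN; exact: qG.
  apply: quasimodular_add; last exact: qG.
  apply: quasimodular_add; first exact: (quasimodular_iterD 2 (qG 2 isT isT)).
  by apply: quasimodularN; apply: quasimodular_D; exact: qG.
have k8 : (8 <= k)%N by move: k k6 ek k6' => [|[|[|[|[|[|[|[|]]]]]]]].
apply: quasimodularZ; apply: quasimodular_add; last first.
  by apply: quasimodularN; apply: qG; [lia|rewrite oddB//; lia].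
apply: quasimodular_add.
  by apply: quasimodularN; apply: (quasimodular_iterD 2); apply: qG; [lia|rewrite oddB//; lia].
apply: quasimodular_add; [apply: (quasimodular_iterD 2)|]; apply: qG;
  [lia|rewrite oddB//; lia|lia|rewrite oddB//; lia].
Qed.

Definition H_coef (k n : nat) : R[i] :=
  if k == 6%N then
    6^-1 * ((n%:R ^+ 2 * G_coef R 2 n - n%:R * G_coef R 2 n + G_coef R 2 n)
            - G_coef R 4 n)
  else
    24^-1 * (- (n%:R ^+ 2 * G_coef R (k - 6) n)
             + (n%:R ^+ 2 * G_coef R (k - 4) n + G_coef R (k - 4) n)
             - G_coef R (k - 2) n).

Lemma q_expansion_H k : q_expansion (H k) (H_coef k).
Proof.
have Gk := @q_expansion_G R; have DGk k' := q_expansion_iterD (n := 2) (Gk k').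
rewrite /H /H_coef; case: eqP => _; apply: q_expansionZ; apply: q_expansionB => //.
  apply: q_expansionD => //; apply: q_expansionB => //; exact: q_expansion_D.
by apply: q_expansionD; [exact: q_expansionN|exact: q_expansionD].
Qed.

Lemma G_coef_pos k n : (0 < n)%N -> G_coef R k n = \sum_(d <- divisors n) d%:R ^+ k.-1.
Proof. by case: n => // n _; rewrite /G_coef mulr0 add0r. Qed.

Definition proper_sum (w : nat -> nat -> nat) (n : nat) : nat :=
  \sum_(d <- divisors n | (d != 1) && (d != n)) w n d.

Lemma proper_sum_eq0 w n : (2 <= n)%N ->
  (forall d, (d %| n)%N -> (1 < d < n)%N -> (0 < w n d)%N) ->
  proper_sum w n = 0%N <-> prime n.
Proof.
move=> n2 w0; have n0 : (0 < n)%N by apply: leq_trans n2.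
split=> [/eqP|pn].
  rewrite /proper_sum sum_nat_seq_eq0 => /allP wn; apply/primeP; split => // d dn.
  have := wn d; rewrite -dvdn_divisors// => /(_ dn).
  have d0 := dvdn_gt0 n0 dn; have dle := dvdn_leq n0 dn.
  have [->//|d1] := eqVneq d 1%N; have [->//|dn1] := eqVneq d n.
  have dprop : (1 < d < n)%N by lia.
  by have := w0 d dn dprop; rewrite lt0n => /negbTE ->.
rewrite /proper_sum big_seq_cond big1// => d.
rewrite -dvdn_divisors// => /and3P[dn d1 dn1].
by case/primeP: pn => _ /(_ d dn); rewrite (negbTE d1) (negbTE dn1).
Qed.

Lemma sum_divisors_ends (g : nat -> R[i]) n : (1 < n)%N ->
  \sum_(d <- divisors n) g d =
  g 1%N + g n + \sum_(d <- divisors n | (d != 1%N) && (d != n)) g d.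
Proof.
move=> n1; have n0 : (0 < n)%N := ltnW n1.
rewrite (bigD1_seq 1%N) ?divisors_uniq//=; last by rewrite -dvdn_divisors.
rewrite -addrA; congr (_ + _); rewrite -big_filter.
rewrite (bigD1_seq n) ?filter_uniq ?divisors_uniq//=; last first.
  by rewrite mem_filter -dvdn_divisors// dvdnn gtn_eqF.
by congr (_ + _); rewrite big_filter_cond; apply: eq_bigl => d; rewrite andbC.
Qed.

(** The contribution of a divisor [d], with [1 < d < n], to the [n]-th
    coefficient of [H k], up to the factor in front. For [k = 6] the
    contributions of [d = 1] and [d = n] cancel; for [k >= 8] both vanish. The
    truncated subtractions are exact for these [d]. *)
Definition H_weight (k n d : nat) : nat :=
  if k == 6%N then (d * ((n ^ 2 - n).+1 - d ^ 2))%N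
  else (d ^ (k - 7) * ((d ^ 2 - 1) * (n ^ 2 - d ^ 2)))%N.

Lemma proper_divisor_le n d : (d %| n)%N -> (d < n)%N -> (2 * d <= n)%N.
Proof.
move=> /dvdnP[c ->]; case: c => [|[|c]] //; rewrite ?mul1n ?ltnn// => _.
by rewrite leq_mul2r orbT.
Qed.

Lemma H_weight_gt0 k n d : (d %| n)%N -> (1 < d < n)%N -> (0 < H_weight k n d)%N.
Proof.
move=> dn /andP[d1 ltdn]; have := proper_divisor_le dn ltdn.
rewrite /H_weight !expnS !expn0 !muln1; case: ifP => _ h.
  by rewrite muln_gt0; apply/andP; split; nia.
by rewrite !muln_gt0 expn_gt0; apply/and3P; split; nia.
Qed.

Lemma H_coefE k n : (6 <= k)%N -> ~~ odd k -> (0 < n)%N ->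
  H_coef k n = (if k == 6%N then 6^-1 else 24^-1) * (proper_sum (H_weight k) n)%:R.
Proof.
move=> k6 ek n0; rewrite /H_coef !G_coef_pos// /proper_sum natr_sum.
have [n1|n1] := leqP n 1.
  have -> : n = 1%N by lia.
  rewrite [divisors 1]/= !big_cons !big_nil/= !expr1n.
  by case: eqP => _; ring.
case: eqP => k6'.
  congr (_ * _); rewrite !mulr_sumr -sumrB -big_split -sumrB/=.
  rewrite sum_divisors_ends// -[RHS]add0r; congr (_ + _); first by rewrite !expr1n; ring.
  rewrite big_seq_cond [RHS]big_seq_cond; apply: eq_bigr => d.
  rewrite -dvdn_divisors// => /and3P[dn d1 dn1].
  have ltdn : (d < n)%N by rewrite ltn_neqAle dn1 dvdn_leq.
  have d2 := proper_divisor_le dn ltdn.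
  rewrite /H_weight k6' eqxx natrM natrB; last by rewrite !expnS !expn0; nia.
  rewrite -natr1 natrB; last by rewrite !expnS !expn0; nia.
  by rewrite !natrX /=; ring.
congr (_ * _).
have k8 : (8 <= k)%N by move: k k6 ek k6' {n0 n1} => [|[|[|[|[|[|[|[|]]]]]]]].
have [m ->] : exists m, k = (m + 7)%N by exists (k - 7)%N; lia.
rewrite !mulr_sumr -sumrN -!big_split -sumrB/=.
rewrite sum_divisors_ends// -[RHS]add0r.
have -> : (m + 7 - 6).-1 = m by lia.
have -> : (m + 7 - 4).-1 = m.+2 by lia.
have -> : (m + 7 - 2).-1 = m.+4 by lia.
congr (_ + _); first by rewrite !expr1n !exprS; ring.
rewrite big_seq_cond [RHS]big_seq_cond; apply: eq_bigr => d.
rewrite -dvdn_divisors// => /and3P[dn d1 dn1].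
have d0 := dvdn_gt0 n0 dn.
have ltdn : (d < n)%N by rewrite ltn_neqAle dn1 dvdn_leq.
rewrite /H_weight; have -> : (m + 7 == 6)%N = false by lia.
rewrite addnK !natrM natrB; last by rewrite expn_gt0 d0.
rewrite natrB; last by rewrite leq_exp2r// ltnW.
by rewrite !natrX !exprS expr0; ring.
Qed.

Lemma Omega_iterD_H n k : (6 <= k)%N -> ~~ odd k -> Omega (iter n D (@H R k)).
Proof.
move=> k6 ek; split; first by apply: quasimodular_iterD; exact: quasimodular_H.
exists (fun m => m%:R ^+ n * H_coef k m); split.
- by apply: q_expansion_iterD; exact: q_expansion_H.
- move=> m m0; rewrite H_coefE// mulr_ge0 ?exprn_ge0// mulr_ge0//.
  by case: ifP => _; rewrite invr_ge0.
- move=> m m2; have m0 : (0 < m)%N by apply: leq_trans m2.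
  rewrite -(proper_sum_eq0 (w := H_weight k))//; last first.
    by move=> d; exact: H_weight_gt0.
  rewrite H_coefE//; split => [/eqP|->]; last by rewrite !mulr0.
  rewrite !mulf_eq0 expf_eq0 pnatr_eq0 gtn_eqF// andbF/=.
  by case: ifP => _; rewrite invr_eq0 !pnatr_eq0/= => /eqP.
Qed.

End PrimeDetection.

(** * Spanning the prime-detecting forms *)

Section LinearSpan.
Variables (K : nzRingType) (V : lmodType K) (S : set V).

Lemma sub_lin_span : S `<=` lin_span S.
Proof.
move=> v Sv; exists 1%N, (fun=> 1), (fun=> v); split => //.
by rewrite big_ord1 scale1r.
Qed.

Lemma lin_span_ind (P : V -> Prop) : P 0 ->
  (forall u v, P u -> P v -> P (u + v)) -> (forall a v, P v -> P (a *: v)) ->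
  (forall v, S v -> P v) -> forall v, lin_span S v -> P v.
Proof.
move=> P0 PD PZ PS v [n [c [w [Sw ->]]]].
by elim/big_ind: _ => // i _; apply/PZ/PS.
Qed.

Lemma lin_span0 : lin_span S 0.
Proof. by exists 0%N, (fun=> 0), (fun=> 0); split => [[]//|]; rewrite big_ord0. Qed.

Lemma lin_spanZ a v : lin_span S v -> lin_span S (a *: v).
Proof.
move=> [n [c [w [Sw ->]]]]; exists n, (fun i => a * c i), w; split => //.
by rewrite scaler_sumr; apply: eq_bigr => i _; rewrite scalerA.
Qed.

Lemma lin_spanD u v : lin_span S u -> lin_span S v -> lin_span S (u + v).
Proof.
move=> [n [c [w [Sw ->]]]] [n' [c' [w' [Sw' ->]]]].
exists (n + n')%N, (fun i => match fintype.split i with inl j => c j | inr j => c' j end),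
  (fun i => match fintype.split i with inl j => w j | inr j => w' j end); split.
  by move=> i; case: fintype.split => j.
rewrite big_split_ord/=; congr (_ + _); apply: eq_bigr => i _.
  by rewrite (unsplitK (inl i)).
by rewrite (unsplitK (inr i)).
Qed.

End LinearSpan.

Section Converse.
Variable R : realType.
Local Notation C := (R[i]^o).
Local Notation form := (uhp R -> C).

Definition H_generators : set form :=
  [set g | exists n k : nat, [/\ (6 <= k)%N, ~~ odd k & g = iter n D (H k)]].

Definition G2_derivatives : set form := [set g | exists n : nat, g = iter n D (G 2)].

Definition reducible (f : form) : Prop :=
  exists u v, [/\ lin_span H_generators u, lin_span G2_derivatives v & f = u + v].

Lemma reducible0 : reducible 0.
Proof. by exists 0, 0; rewrite addr0; split => //; exact: lin_span0. Qed.

Lemma reducibleD f g : reducible f -> reducible g -> reducible (f + g).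
Proof.
move=> [u [v [Hu Gv ->]]] [u' [v' [Hu' Gv' ->]]].
by exists (u + u'), (v + v'); rewrite addrACA; split => //; exact: lin_spanD.
Qed.

Lemma reducibleZ a f : reducible f -> reducible (a *: f).
Proof.
move=> [u [v [Hu Gv ->]]]; exists (a *: u), (a *: v); rewrite scalerDr.
by split => //; exact: lin_spanZ.
Qed.

Lemma reducible_iterD_H n k : (6 <= k)%N -> ~~ odd k -> reducible (iter n D (H k)).
Proof.
move=> k6 ek; exists (iter n D (H k)), 0; rewrite addr0; split => //.
  by apply: sub_lin_span; exists n, k.
exact: lin_span0.
Qed.

Lemma reducible_iterD_G2 n : reducible (iter n D (G 2)).
Proof.
exists 0, (iter n D (G 2)); rewrite add0r; split => //; first exact: lin_span0.
by apply: sub_lin_span; exists n.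
Qed.

(** Solving the definition of [H (k + 2)] for [G k] leaves only [G (k - 2)],
    [G (k - 4)] and their derivatives; [H 6] does the same for [G 4]. The
    identities are checked on coefficients. *)
Lemma reducible_iterD_G k n : (2 <= k)%N -> ~~ odd k -> reducible (iter n D (G k)).
Proof.
have Gq j m := @q_expansion_iterD R _ _ m (@q_expansion_G R j).
have Hq j m := @q_expansion_iterD R _ _ m (@q_expansion_H R j).
elim/ltn_ind: k n => k IHk n k2 ek.
have [->|k2'] := eqVneq k 2%N; first exact: reducible_iterD_G2.
have [->|k4'] := eqVneq k 4%N.
  have -> : iter n D (G 4) = (iter n.+2 D (G 2) + (-1) *: iter n.+1 D (G 2))
     + (iter n D (G 2) + (- 6) *: iter n D (@H R 6)).
    apply: q_expansion_eq (Gq 4 n) _.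
    have := q_expansionD
      (q_expansionD (Gq 2 n.+2) (q_expansionZ (a := -1) (Gq 2 n.+1)))
      (q_expansionD (Gq 2 n) (q_expansionZ (a := -6) (Hq 6 n))).
    by congr q_expansion; apply/funext => m; rewrite /H_coef eqxx !exprS; field.
  apply: reducibleD; apply: reducibleD.
  - exact: reducible_iterD_G2.
  - by apply: reducibleZ; exact: reducible_iterD_G2.
  - exact: reducible_iterD_G2.
  - by apply: reducibleZ; exact: reducible_iterD_H.
have k6 : (6 <= k)%N by move: k k2 ek k2' k4' {IHk} => [|[|[|[|[|[|]]]]]].
have -> : iter n D (G k) = ((-1) *: iter n.+2 D (G (k - 4)) + iter n.+2 D (G (k - 2)))
   + (iter n D (G (k - 2)) + (- 24) *: iter n D (@H R (k + 2))).
  apply: q_expansion_eq (Gq k n) _.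
  have := q_expansionD
    (q_expansionD (q_expansionZ (a := -1) (Gq (k - 4)%N n.+2)) (Gq (k - 2)%N n.+2))
    (q_expansionD (Gq (k - 2)%N n) (q_expansionZ (a := -24) (Hq (k + 2)%N n))).
  congr q_expansion; apply/funext => m; rewrite /H_coef.
  have -> : (k + 2 == 6)%N = false by lia.
  have -> : (k + 2 - 6 = k - 4)%N by lia.
  have -> : (k + 2 - 4 = k - 2)%N by lia.
  by rewrite addnK !exprS; field.
apply: reducibleD; apply: reducibleD.
- by apply: reducibleZ; apply: IHk; [lia|lia|rewrite oddB//; lia].
- by apply: IHk; [lia|lia|rewrite oddB//; lia].
- by apply: IHk; [lia|lia|rewrite oddB//; lia].
- by apply: reducibleZ; apply: reducible_iterD_H; [lia|rewrite oddD addbF].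
Qed.

Lemma lin_span_H_prime_coef (u : form) : lin_span H_generators u ->
  exists2 b, q_expansion u b & forall p, prime p -> b p = 0.
Proof.
apply: (lin_span_ind (P := fun u => exists2 b, q_expansion u b &
  forall p, prime p -> b p = 0)) => [|f g [a fa a0] [b gb b0]|c f [a fa a0]|f].
- by exists (fun=> 0) => //; exact: q_expansion0.
- exists (fun n => a n + b n); first exact: q_expansionD.
  by move=> p pp; rewrite a0// b0// addr0.
- exists (fun n => c * a n); first exact: q_expansionZ.
  by move=> p pp; rewrite a0// mulr0.
move=> [n [k [k6 ek ->]]].
exists (fun m => m%:R ^+ n * H_coef R k m).
  by apply: q_expansion_iterD; exact: q_expansion_H.
move=> p pp; have p2 := prime_gt1 pp.
rewrite H_coefE ?prime_gt0//.
have -> : proper_sum (H_weight k) p = 0%N.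
  by apply/proper_sum_eq0 => // d; exact: H_weight_gt0.
by rewrite !mulr0.
Qed.

(** [D] acts on coefficients as multiplication by the index, so a combination
    of derivatives of [G 2] multiplies its [n]-th coefficient by the value of a
    polynomial at [n]. *)
Lemma lin_span_G2_coef (v : form) : lin_span G2_derivatives v ->
  exists P : {poly R[i]}, q_expansion v (fun n => P.[n%:R] * G_coef R 2 n).
Proof.
apply: (lin_span_ind (P := fun v => exists P : {poly R[i]},
  q_expansion v (fun n => P.[n%:R] * G_coef R 2 n)))
  => [|f g [P fP] [Q gQ]|c f [P fP]|f].
- exists 0; have := @q_expansion0 R; congr q_expansion.
  by apply/funext => n; rewrite horner0 mul0r.
- exists (P + Q); have := q_expansionD fP gQ; congr q_expansion.
  by apply/funext => n; rewrite hornerD mulrDl.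
- exists (c *: P); have := q_expansionZ (a := c) fP; congr q_expansion.
  by apply/funext => n; rewrite hornerZ mulrA.
move=> [n ->]; exists 'X^n.
have := q_expansion_iterD (n := n) (@q_expansion_G R 2); congr q_expansion.
by apply/funext => m; rewrite hornerXn.
Qed.

Lemma G_coef2_neq0 n : (0 < n)%N -> G_coef R 2 n != 0.
Proof.
move=> n0; rewrite G_coef_pos// (bigD1_seq n) ?divisors_uniq//=; last first.
  by rewrite -dvdn_divisors.
by rewrite gt_eqF// ltr_pwDl ?expr1 ?ltr0n// sumr_ge0// => d _; rewrite exprn_ge0.
Qed.

Lemma poly_prime_roots_eq0 (P : {poly R[i]}) :
  (forall p : nat, prime p -> P.[p%:R] = 0) -> P = 0.
Proof.
move=> Pp; apply/eqP/negPn/negP => P0.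
have primes_seq N : exists s : seq nat, [/\ uniq s, size s = N & all prime s].
  elim: N => [|N [s [us sN ps]]]; first by exists [::].
  have [p sp pp] := prime_above (\sum_(i <- s) i).
  exists (p :: s) => /=; rewrite us sN ps pp andbT; split => //.
  apply/negP => pins; move: sp; rewrite (bigD1_seq p)//=.
  by rewrite ltnNge leq_addr.
have [s [us sP ps]] := primes_seq (size P).
have := max_poly_roots (rs := [seq p%:R | p <- s]) P0; rewrite size_map sP ltnn.
suff [-> ->] : all (root P) [seq p%:R | p <- s] /\ uniq [seq p%:R : R[i] | p <- s].
  by move=> /(_ isT isT).
split; last by rewrite map_inj_uniq// => m n /eqP; rewrite eqr_nat => /eqP.
rewrite all_map; apply/allP => p sp; apply/rootP/Pp.
by move/allP: ps => /(_ _ sp).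
Qed.

Lemma Eisenstein_Omega_span (f : form) :
  (Eisenstein_space `&` Omega) f -> lin_span H_generators f.
Proof.
move=> [Ef [_ [b [fb _ bP]]]].
have [u [v [Hu Gv fuv]]] : reducible f.
  apply: (lin_span_ind (P := reducible)) Ef => [|||g [n [k [k2 ek ->]]]].
  - exact: reducible0.
  - exact: reducibleD.
  - exact: reducibleZ.
  exact: reducible_iterD_G.
have [a ua a0] := lin_span_H_prime_coef Hu.
have [P vP] := lin_span_G2_coef Gv.
have ab : b = (fun n => a n + P.[n%:R] * G_coef R 2 n).
  by apply: q_expansion_inj fb _; rewrite fuv; exact: q_expansionD.
have P0 : P = 0.
  apply: poly_prime_roots_eq0 => p pp.
  have [_ /(_ pp)] := bP p (prime_gt1 pp).
  rewrite ab a0// add0r => /eqP; rewrite mulf_eq0 (negbTE (G_coef2_neq0 _)) ?orbF ?prime_gt0//.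
  by move/eqP.
have v0 : v = 0.
  apply: q_expansion_eq vP _; have := @q_expansion0 R; congr q_expansion.
  by apply/funext => n; rewrite P0 horner0 mul0r.
by rewrite fuv v0 addr0.
Qed.

End Converse.

Theorem theorem2p3 (R : realType) :
  (forall n k : nat, (6 <= k)%N -> ~~ odd k ->
     Omega (iter n D (H k : uhp R -> R[i]^o)))
  /\
  (forall f : uhp R -> R[i]^o,
     (Eisenstein_space `&` Omega) f ->
     lin_span [set g | exists n k : nat,
       [/\ (6 <= k)%N, ~~ odd k & g = iter n D (H k)]] f).
Proof.
split; first by move=> n k; exact: Omega_iterD_H.
exact: Eisenstein_Omega_span.
Qed.
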